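(* Let $(\Lambda(U\oplus V),d)$ be a minimal Sullivan algebra over $\mathbb{Q}$ (with $U\oplus V$ concentrated in degrees $\geq 2$) which is elliptic, i.e. $\dim(U\oplus V)<\infty$ and $\dim H(\Lambda(U\oplus V),d)<\infty$, and which is a $2$-stage algebra, i.e. $d(U)=0$ and $d(V)\subseteq \Lambda U$ (no a priori restriction on the parity of degrees of $U$ and $V$). Then $$\dim H(\Lambda(U\oplus V),d)\;\geq\; \dim (U\oplus V).$$ Equivalently, every simply connected rationally elliptic space whose minimal Sullivan model is of this form satisfies the Hilali conjecture $\dim H^*(X;\mathbb{Q})\geq \dim \pi_*(X)\otimes\mathbb{Q}$.
   Context: For a minimal Sullivan model $(\Lambda W,d)$ of a simply connected space $X$, $\dim W=\dim \pi_*(X)\otimes\mathbb{Q}$ and $H(\Lambda W,d)\cong H^*(X;\mathbb{Q})$. The Hilali conjecture for such an algebra is the inequality $\dim H(\Lambda W,d)\geq \dim W$. *)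

(* Defs.v *)
From mathcomp Require Import all_boot all_order all_algebra.
From mathcomp Require Export mpoly.
Set Implicit Arguments. Unset Strict Implicit. Unset Printing Implicit Defensive.
Import Order.TTheory GRing.Theory Num.Theory.
Local Open Scope ring_scope.

(* The free graded-commutative algebra Lambda W over Q on k generators
   x_0, ..., x_{k-1} of degrees deg i is modelled inside {mpoly rat[k]}:
   a monomial m : 'X_{1..k} stands for the ORDERED product
   x_0^(m 0) * x_1^(m 1) * ... * x_{k-1}^(m (k-1)),
   and it is a basis element of Lambda W iff every odd-degree generator
   occurs with exponent <= 1 ("valid" monomial). Elements of Lambda W are the
   polynomials supported on valid monomials. *)

Definition wdeg (k : nat) (deg : 'I_k -> nat) (m : 'X_{1..k}) : nat :=
  (\sum_(i < k) m i * deg i)%N.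

Definition valid (k : nat) (deg : 'I_k -> nat) (m : 'X_{1..k}) : bool :=
  [forall i, odd (deg i) ==> (m i <= 1)%N].

Definition isLam (k : nat) (deg : 'I_k -> nat) (p : {mpoly rat[k]}) : bool :=
  all (valid deg) (msupp p).

Definition hmg (k : nat) (deg : 'I_k -> nat) (n : nat) (p : {mpoly rat[k]}) : bool :=
  all (fun m => wdeg deg m == n) (msupp p).

(* Koszul sign exponent for x^m * x^m' = (-1)^(sgnexp m m') x^(m+m'):
   each x_j^(m' j) is moved left past x_i^(m i) for i > j. *)
Definition sgnexp (k : nat) (deg : 'I_k -> nat) (m m' : 'X_{1..k}) : nat :=
  (\sum_(i < k) \sum_(j < k | (j < i)%N) m i * m' j * deg i * deg j)%N.

Definition lmul (k : nat) (deg : 'I_k -> nat) (p q : {mpoly rat[k]}) : {mpoly rat[k]} :=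
  \sum_(m <- msupp p) \sum_(m' <- msupp q)
     (((-1) ^+ sgnexp deg m m') * p@_m * q@_m' * (valid deg (mnm_add m m'))%:R)
       *: 'X_[mnm_add m m'].

Definition is_differential (k : nat) (deg : 'I_k -> nat)
    (d : {mpoly rat[k]} -> {mpoly rat[k]}) : Prop :=
  [/\ (forall (a : rat) p q, d (a *: p + q) = a *: d p + d q),
      (forall p, isLam deg p -> isLam deg (d p)),
      (forall n p, isLam deg p -> hmg deg n p -> hmg deg n.+1 (d p)),
      (forall n a b, isLam deg a -> isLam deg b -> hmg deg n a ->
         d (lmul deg a b) = lmul deg (d a) b + (-1) ^+ n * lmul deg a (d b)) &
      (forall p, isLam deg p -> d (d p) = 0)].

Definition minimal_diff (k : nat) (d : {mpoly rat[k]} -> {mpoly rat[k]}) : Prop :=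
  forall i : 'I_k, all (fun m => 2 <= mdeg m)%N (msupp (d 'X_i)).

Definition two_stage (k : nat) (inU : 'I_k -> bool)
    (d : {mpoly rat[k]} -> {mpoly rat[k]}) : Prop :=
  forall i : 'I_k,
    (inU i -> d 'X_i = 0) /\
    (~~ inU i -> all (fun m : 'X_{1..k} => [forall j, ~~ inU j ==> (m j == 0%N)])
                     (msupp (d 'X_i))).

Definition cocycle (k : nat) (deg : 'I_k -> nat)
    (d : {mpoly rat[k]} -> {mpoly rat[k]}) (z : {mpoly rat[k]}) : Prop :=
  isLam deg z /\ d z = 0.

Definition coboundary (k : nat) (deg : 'I_k -> nat)
    (d : {mpoly rat[k]} -> {mpoly rat[k]}) (z : {mpoly rat[k]}) : Prop :=
  exists y, isLam deg y /\ z = d y.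

Definition finite_cohomology (k : nat) (deg : 'I_k -> nat)
    (d : {mpoly rat[k]} -> {mpoly rat[k]}) : Prop :=
  exists (N : nat) (c : 'I_N -> {mpoly rat[k]}),
    (forall i, cocycle deg d (c i)) /\
    (forall z, cocycle deg d z ->
       exists a : 'I_N -> rat, coboundary deg d (z - \sum_(i < N) a i *: c i)).

Definition cohom_dim_ge (k : nat) (deg : 'I_k -> nat)
    (d : {mpoly rat[k]} -> {mpoly rat[k]}) (r : nat) : Prop :=
  exists z : 'I_r -> {mpoly rat[k]},
    (forall i, cocycle deg d (z i)) /\
    (forall a : 'I_r -> rat,
       coboundary deg d (\sum_(i < r) a i *: z i) -> forall i, a i = 0).

(* Main.v *)
Require Import Defs.
From mathcomp Require Import all_boot all_order all_algebra.
From mathcomp Require Import mpoly.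
From mathcomp Require Import zify.
From Stdlib Require Import Classical.
Set Implicit Arguments. Unset Strict Implicit. Unset Printing Implicit Defensive.
Import GRing.Theory.
Local Open Scope ring_scope.

(** Let U have n even and p odd generators and let V have m generators.
    Word length in V gives a second grading H = (+)_q H_q of the cohomology.

    1. V is odd. Reduce modulo the generators of U one at a time, the even ones
       first. If Lambda W / J has no homology in large V-degree, neither has
       Lambda W / (J, x): for x even by the long exact sequence; for u odd because
       z |-> (dz)/u is then invertible on the homology of Lambda W / (J, u) in large
       V-degree, whereas it is nilpotent, as minimality makes d raise the word length
       in U by 2. Modulo all of U the differential vanishes, so that the powers of an
       even y in V would be nontrivial classes of arbitrarily large V-degree.
    2. Some powers x_i^N are exact, hence act as 0 on homology, so reducing modulo
       a further x_i^N gives short exact sequences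
       0 -> H_q(I) -> H_q(I, x_i^N) -> H_(q-1)(I) -> 0. Modulo all of them H_q
       vanishes for q > m and H_m is an annihilator containing the 1 + n + p monomials
       of maximal and submaximal length in U. Hence n <= m and
       dim H_(m-n) >= 1 + n + p.
    3. Rigidity: H_q = 0 implies H_(q+1) = 0, by induction on the generators of V
       and Nakayama's lemma. So H_q <> 0 for 0 <= q <= m - n.
    4. By minimality 1 and U give 1 + n + p classes in H_0. If m > n the total is at
       least 2 (1 + n + p) + (m - n - 1) >= n + p + m. If m = n > 0, at most n of the
       2n - 1 quadratic monomials x_1 x_i, x_i^2 (i > 1) become dependent in H_0, and
       the total is at least (1 + n + p) + (n - 1) = n + p + m. *)

(** * Polynomials supported on a set of monomials *)

Section Support.
Variable k : nat.
Implicit Types (p q : {mpoly rat[k]}) (m : 'X_{1..k}) (P Q : pred 'X_{1..k}).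

Definition supported P p := all P (msupp p).

Lemma supportedP P p : reflect (forall m, p@_m != 0 -> P m) (supported P p).
Proof.
by apply: (iffP allP) => h m; move: (h m); rewrite mcoeff_msupp.
Qed.

Lemma supportedS P Q p : (forall m, P m -> Q m) -> supported P p -> supported Q p.
Proof. by move=> PQ /supportedP h; apply/supportedP=> m /h /PQ. Qed.

Lemma supported_and P Q p :
  supported (fun m => P m && Q m) p = supported P p && supported Q p.
Proof. exact: all_predI. Qed.

Lemma supported_pred0 p : supported pred0 p -> p = 0.
Proof.
move=> /supportedP h; apply/mpolyP=> m; rewrite mcoeff0; apply/eqP.
by apply: contraT => /h.
Qed.

Lemma supported0 P : supported P 0.
Proof. by apply/supportedP=> m; rewrite mcoeff0 eqxx. Qed.

Lemma supportedD P p q : supported P p -> supported P q -> supported P (p + q).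
Proof.
move=> /supportedP hp /supportedP hq; apply/supportedP=> m; rewrite mcoeffD.
by case: (eqVneq p@_m 0) => [-> | /hp //]; rewrite add0r => /hq.
Qed.

Lemma supportedZ P a p : supported P p -> supported P (a *: p).
Proof.
move=> /supportedP hp; apply/supportedP=> m; rewrite mcoeffZ mulf_eq0 negb_or.
by case/andP=> _ /hp.
Qed.

Lemma supportedN P p : supported P p -> supported P (- p).
Proof. by rewrite -scaleN1r; apply: supportedZ. Qed.

Lemma supportedB P p q : supported P p -> supported P q -> supported P (p - q).
Proof. by move=> hp hq; apply: supportedD => //; apply: supportedN. Qed.

Lemma supported_sum P (I : eqType) (r : seq I) (A : pred I) (F : I -> {mpoly rat[k]}) :
  (forall i, i \in r -> A i -> supported P (F i)) ->
  supported P (\sum_(i <- r | A i) F i).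
Proof.
move=> h; rewrite big_seq_cond; apply: (big_ind (supported P)) => [|p q|i /andP[]].
- exact: supported0.
- exact: supportedD.
- exact: h.
Qed.

Lemma supportedX P m : supported P 'X_[m] = P m.
Proof. by rewrite /supported msuppX /= andbT. Qed.

Definition restr P p := \sum_(m <- msupp p | P m) p@_m *: 'X_[m].

Lemma mcoeff_restr P p m : (restr P p)@_m = if P m then p@_m else 0.
Proof.
rewrite /restr raddf_sum /=.
under eq_bigr do rewrite mcoeffZ mcoeffX.
case: (boolP (m \in msupp p)) => [mp | mp].
  rewrite big_mkcond (bigD1_seq m) ?msupp_uniq //= eqxx mulr1 big1 ?addr0 // => i im.
  by rewrite (negPf im) mulr0 if_same.
rewrite (memN_msupp_eq0 mp) if_same big_seq_cond big1 // => i /andP[ip _].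
by case: eqP => [e | _]; rewrite ?mulr0 //; rewrite -e ip in mp.
Qed.

Lemma restrD P p q : restr P (p + q) = restr P p + restr P q.
Proof.
by apply/mpolyP=> m; rewrite !(mcoeff_restr, mcoeffD); case: (P m); rewrite ?addr0.
Qed.

Lemma restrB P p q : restr P (p - q) = restr P p - restr P q.
Proof.
by apply/mpolyP=> m; rewrite !(mcoeff_restr, mcoeffB); case: (P m); rewrite ?subr0.
Qed.

Lemma restrZ P a p : restr P (a *: p) = a *: restr P p.
Proof.
by apply/mpolyP=> m; rewrite !(mcoeff_restr, mcoeffZ); case: (P m); rewrite ?mulr0.
Qed.

Lemma restr_sum P (I : Type) (r : seq I) (F : I -> {mpoly rat[k]}) :
  restr P (\sum_(i <- r) F i) = \sum_(i <- r) restr P (F i).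
Proof.
apply/mpolyP=> m; rewrite mcoeff_restr !raddf_sum /=.
under [RHS]eq_bigr do rewrite mcoeff_restr.
by case: (P m) => //; rewrite big1.
Qed.

Lemma restr_supp P p : supported P (restr P p).
Proof. by apply/supportedP=> m; rewrite mcoeff_restr; case: (P m); rewrite ?eqxx. Qed.

Lemma restr_keep P Q p : supported Q p -> supported Q (restr P p).
Proof.
move=> /supportedP h; apply/supportedP=> m; rewrite mcoeff_restr.
by case: (P m); rewrite ?eqxx // => /h.
Qed.

Lemma restrC_supp P p : supported (predC P) (p - restr P p).
Proof.
apply/supportedP=> m; rewrite mcoeffB mcoeff_restr /=.
by case: (P m); rewrite ?subrr ?eqxx.
Qed.

Lemma restr_id P p : supported P p -> restr P p = p.
Proof.
move=> /supportedP h; apply/mpolyP=> m; rewrite mcoeff_restr.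
by case: ifPn => // nP; apply/eqP; rewrite eq_sym; apply: contraNT nP => /h.
Qed.

Lemma restr_eq0 P p : supported (predC P) p -> restr P p = 0.
Proof.
move=> /supportedP h; apply/mpolyP=> m; rewrite mcoeff_restr mcoeff0.
by case: ifPn => // Pm; apply/eqP; apply: contraTT Pm => /h.
Qed.

End Support.

(** * The graded product with a monomial *)

Section Lmul.
Variables (k : nat) (deg : 'I_k -> nat).
Implicit Types (p q : {mpoly rat[k]}) (m u : 'X_{1..k}) (P Q : pred 'X_{1..k}).

Lemma validP m : reflect (forall i, odd (deg i) -> (m i <= 1)%N) (valid deg m).
Proof.
by apply: (iffP forallP) => h i; move/(_ i): h; [move=> /implyP | move=> h; apply/implyP].
Qed.

Lemma valid_le m m' : (forall i, (m i <= m' i)%N) -> valid deg m' -> valid deg m.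
Proof.
by move=> le_m /validP h; apply/validP=> i /h; apply: leq_trans.
Qed.

Lemma wdegD m m' : wdeg deg (m + m') = (wdeg deg m + wdeg deg m')%N.
Proof. by rewrite /wdeg -big_split; apply: eq_bigr => i _; rewrite mnmDE mulnDl. Qed.

Lemma wdeg1 i : wdeg deg U_(i) = deg i.
Proof.
rewrite /wdeg (bigD1 i) //= mnm1E eqxx mul1n big1 ?addn0 // => j ji.
by rewrite mnm1E eq_sym (negPf ji).
Qed.

Lemma LamX m : isLam deg 'X_[m] = valid deg m.
Proof. exact: supportedX. Qed.

Lemma hmgX n m : hmg deg n 'X_[m] = (wdeg deg m == n).
Proof. exact: supportedX (fun m => wdeg deg m == n) m. Qed.

Lemma supported_lmul P Q (T : pred 'X_{1..k}) p q :
  (forall m m', P m -> Q m' -> valid deg (m + m') -> T (m + m')%MM) ->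
  supported P p -> supported Q q -> supported T (lmul deg p q).
Proof.
move=> h /allP hp /allP hq; apply: supported_sum => m mp _.
apply: supported_sum => m' mq _.
case: (boolP (valid deg (m + m'))) => v; last by rewrite mulr0 scale0r supported0.
by apply: supportedZ; rewrite supportedX; apply: h => //; [apply: hp | apply: hq].
Qed.

Lemma mcoeff_lmulX u p m :
  (lmul deg 'X_[u] p)@_(u + m) =
  (-1) ^+ sgnexp deg u m * p@_m * (valid deg (u + m))%:R.
Proof.
rewrite /lmul msuppX big_seq1 raddf_sum /=.
under eq_bigr do rewrite mcoeffZ !mcoeffX eqxx mulr1 eqm_add2l.
case: (boolP (m \in msupp p)) => [mp | mp].
  rewrite (bigD1_seq m) ?msupp_uniq //= eqxx mulr1 big1 ?addr0 // => i im.
  by rewrite (negPf im) mulr0.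
rewrite (memN_msupp_eq0 mp) mulr0 mul0r big_seq big1 // => i ip.
by case: eqP => [e | _]; rewrite ?mulr0 //; rewrite -e ip in mp.
Qed.

Lemma mcoeff_lmulX0 u p m : ~~ (u <= m)%MM -> (lmul deg 'X_[u] p)@_m = 0.
Proof.
move=> h; rewrite /lmul msuppX big_seq1 raddf_sum /= big1 // => m' _.
rewrite mcoeffZ !mcoeffX eqxx; case: eqP => [e | _]; last by rewrite mulr0.
by rewrite -e lem_addr in h.
Qed.

Lemma lmulX_linear u : linear (lmul deg 'X_[u]).
Proof.
move=> a p q; apply/mpolyP=> m; rewrite mcoeffD mcoeffZ.
case: (boolP (u <= m)%MM) => [le_um | h]; last by rewrite !mcoeff_lmulX0 // mulr0 addr0.
rewrite -(submK le_um) addmC !mcoeff_lmulX mcoeffD mcoeffZ mulrDr mulrDl.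
by congr (_ + _); rewrite mulrCA !mulrA.
Qed.

Lemma lmulXD u p q : lmul deg 'X_[u] (p + q) = lmul deg 'X_[u] p + lmul deg 'X_[u] q.
Proof. by have := lmulX_linear u 1 p q; rewrite !scale1r. Qed.

Lemma lmulX0 u : lmul deg 'X_[u] 0 = 0.
Proof. by apply: (addrI (lmul deg 'X_[u] 0)); rewrite -lmulXD !addr0. Qed.

Lemma lmulXZ u a p : lmul deg 'X_[u] (a *: p) = a *: lmul deg 'X_[u] p.
Proof. by have := lmulX_linear u a p 0; rewrite lmulX0 !addr0. Qed.

Lemma lmulXN u p : lmul deg 'X_[u] (- p) = - lmul deg 'X_[u] p.
Proof. by rewrite -scaleN1r lmulXZ scaleN1r. Qed.

Lemma lmulXB u p q : lmul deg 'X_[u] (p - q) = lmul deg 'X_[u] p - lmul deg 'X_[u] q.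
Proof. by rewrite lmulXD lmulXN. Qed.

Lemma lmulX_sum u (I : Type) (r : seq I) (F : I -> {mpoly rat[k]}) :
  lmul deg 'X_[u] (\sum_(i <- r) F i) = \sum_(i <- r) lmul deg 'X_[u] (F i).
Proof. exact: (big_morph _ (lmulXD u) (lmulX0 u)). Qed.

Lemma lmulXX u m : valid deg (u + m) ->
  lmul deg 'X_[u] 'X_[m] = (-1) ^+ sgnexp deg u m *: 'X_[u + m].
Proof.
by move=> v; rewrite /lmul !msuppX !big_seq1 v !mcoeffX !eqxx !mulr1.
Qed.

Lemma signZZ n p : (-1) ^+ n *: ((-1) ^+ n *: p) = p.
Proof. by rewrite scalerA -expr2 sqrr_sign scale1r. Qed.

Lemma supported_lmulX_inv P u p :
  supported P (lmul deg 'X_[u] p) ->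
  supported (fun m => valid deg (u + m) ==> P (u + m)%MM) p.
Proof.
move=> /supportedP h; apply/supportedP=> m pm; apply/implyP=> v; apply: h.
by rewrite mcoeff_lmulX v mulr1 mulf_eq0 negb_or pm signr_eq0.
Qed.

(** Divide each monomial by [u] and undo its Koszul sign; divisors of valid monomials are valid. *)
Lemma lmulX_div P u q :
  supported (fun m => valid deg m && (u <= m)%MM) q -> supported P q ->
  exists2 p, lmul deg 'X_[u] p = q &
    supported (fun m => valid deg m && P (u + m)%MM) p.
Proof.
move=> /allP hq /allP hP.
exists (\sum_(m <- msupp q) ((-1) ^+ sgnexp deg u (m - u)%MM * q@_m) *: 'X_[m - u]).
  rewrite lmulX_sum [RHS]mpolyE big_seq [RHS]big_seq; apply: eq_bigr => m /hq /andP[v le_um].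
  have e : (u + (m - u))%MM = m by rewrite addmC submK.
  by rewrite lmulXZ lmulXX e // mulrC -scalerA signZZ.
apply: supported_sum => m mq _; apply: supportedZ; rewrite supportedX.
have /andP[v le_um] := hq _ mq.
have e : (u + (m - u))%MM = m by rewrite addmC submK.
rewrite e hP // andbT; apply: valid_le v => i.
by rewrite mnmBE leq_subr.
Qed.

End Lmul.

(** * The differential on monomials *)

Section Differential.
Variables (k : nat) (deg : 'I_k -> nat) (inU : 'I_k -> bool).
Variable d : {mpoly rat[k]} -> {mpoly rat[k]}.
Hypothesis deg_ge2 : forall i, (2 <= deg i)%N.
Hypothesis d_diff : is_differential deg d.
Hypothesis d_min : minimal_diff d.
Hypothesis d_2stage : two_stage inU d.
Implicit Types (q r : nat) (p w z : {mpoly rat[k]}) (m u : 'X_{1..k}) (P Q : pred 'X_{1..k}).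

Definition udeg m : nat := (\sum_(i | inU i) m i)%N.
Definition vdeg m : nat := (\sum_(i | ~~ inU i) m i)%N.

Lemma udegD m m' : udeg (m + m') = (udeg m + udeg m')%N.
Proof. by rewrite /udeg -big_split; apply: eq_bigr => i _; rewrite mnmDE. Qed.

Lemma vdegD m m' : vdeg (m + m') = (vdeg m + vdeg m')%N.
Proof. by rewrite /vdeg -big_split; apply: eq_bigr => i _; rewrite mnmDE. Qed.

Lemma mdeg_uv m : mdeg m = (udeg m + vdeg m)%N.
Proof. by rewrite mdegE (bigID inU). Qed.

Lemma udeg1 i : udeg U_(i) = inU i.
Proof.
rewrite /udeg; under eq_bigr do rewrite mnm1E.
case: (boolP (inU i)) => iU; last first.
  by rewrite big1 // => j jU; case: eqP iU => // ->; rewrite jU.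
rewrite (bigD1 i) //= eqxx big1 // => j /andP[_].
by rewrite eq_sym => /negPf->.
Qed.

Lemma vdeg1 i : vdeg U_(i) = ~~ inU i.
Proof. by apply/eqP; rewrite -(eqn_add2l (udeg U_(i))) -mdeg_uv mdeg1 udeg1; case: (inU i). Qed.

Lemma dD p p' : d (p + p') = d p + d p'.
Proof. by case: d_diff => lin _ _ _ _; have := lin 1 p p'; rewrite !scale1r. Qed.

Lemma d0 : d 0 = 0.
Proof. by apply: (addrI (d 0)); rewrite -dD !addr0. Qed.

Lemma dZ a p : d (a *: p) = a *: d p.
Proof. by case: d_diff => lin _ _ _ _; have := lin a p 0; rewrite d0 !addr0. Qed.

Lemma dN p : d (- p) = - d p.
Proof. by rewrite -scaleN1r dZ scaleN1r. Qed.

Lemma dB p p' : d (p - p') = d p - d p'.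
Proof. by rewrite dD dN. Qed.

Lemma d_sum (I : Type) (r : seq I) (F : I -> {mpoly rat[k]}) :
  d (\sum_(i <- r) F i) = \sum_(i <- r) d (F i).
Proof. exact: (big_morph _ dD d0). Qed.

Lemma d_Lam p : isLam deg p -> isLam deg (d p).
Proof. by case: d_diff => _ h _ _ _; apply: h. Qed.

Lemma dd0 p : isLam deg p -> d (d p) = 0.
Proof. by case: d_diff => _ _ _ _ h; apply: h. Qed.

Lemma isLam1 i : isLam deg 'X_i.
Proof.
rewrite LamX; apply/validP=> j _; rewrite mnm1E; exact: leq_b1.
Qed.

(** The sign becomes a rational scalar instead of a polynomial factor, so that linearity applies to
    it. *)
Lemma d_leibniz n a b : isLam deg a -> isLam deg b -> hmg deg n a ->
  d (lmul deg a b) = lmul deg (d a) b + (-1) ^+ n *: lmul deg a (d b).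
Proof.
case: d_diff => _ _ _ h _ La Lb ha; rewrite (h n) //; congr (_ + _).
by rewrite -signr_odd -[in RHS]signr_odd; case: odd; rewrite ?scaleN1r ?mulN1r ?scale1r ?mul1r.
Qed.

Lemma dU i : inU i -> d 'X_i = 0.
Proof. by case: (d_2stage i). Qed.

Lemma dV_supp j u : ~~ inU j -> u \in msupp (d 'X_j) ->
  [/\ wdeg deg u = (deg j).+1, vdeg u = 0%N & (2 <= udeg u)%N].
Proof.
move=> jV uj; have [_ /(_ jV) /allP/(_ _ uj)/forallP u_in] := d_2stage j.
have v0 : vdeg u = 0%N.
  by apply: big1 => i iV; apply/eqP; have := u_in i; rewrite iV.
split=> //; last first.
  by have /allP/(_ _ uj) := d_min j; rewrite mdeg_uv v0 addn0.
have [_ _ h _ _] := d_diff.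
have /allP/(_ _ uj)/eqP // : hmg deg (deg j).+1 (d 'X_j).
by apply: h; rewrite ?isLam1 // hmgX wdeg1.
Qed.

(* [step m m']: the monomial m' is obtained from m by replacing one factor x_j of V
   by a monomial of d x_j; these are the only monomials occurring in d x^m. *)
Definition step m m' : bool :=
  [exists j, [&& ~~ inU j, (0 < m j)%N &
     has (fun u => (U_(j) + m' == m + u)%MM) (msupp (d 'X_j))]].

Lemma stepP m m' : reflect
  (exists j u, [/\ ~~ inU j, (0 < m j)%N, u \in msupp (d 'X_j) & (U_(j) + m' = m + u)%MM])
  (step m m').
Proof.
apply: (iffP existsP) => [[j /and3P[jV mj /hasP[u uj /eqP e]]] | [j [u [jV mj uj e]]]].
  by exists j, u.
by exists j; rewrite jV mj; apply/hasP; exists u => //; apply/eqP.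
Qed.

(** The Leibniz rule for the product of 1 with itself gives d 1 = d 1 + d 1. For [lmul], 1 is
    neutral only on polynomials with valid monomials, hence the detour through [d_Lam]. *)
Lemma d1 : d 1 = 0.
Proof.
have L1 : isLam deg 1.
  rewrite -mpolyX0 LamX; apply/validP=> i _; by rewrite mnm0E.
have h1 : hmg deg 0 1.
  rewrite -mpolyX0 hmgX.
  by apply/eqP; apply: big1 => i _; rewrite mnm0E.
have e11 : forall p, isLam deg p -> lmul deg 1 p = p.
  move=> p /supportedP Lp; apply/mpolyP=> m; rewrite -mpolyX0 -{1}[m]add0m mcoeff_lmulX.
  rewrite /sgnexp big1 ?mul1r; last by move=> i _; apply: big1 => j _; rewrite mnm0E.
  rewrite add0m; case: (eqVneq p@_m 0) => [-> | /Lp ->]; by rewrite ?mul0r ?mulr1.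
have e12 : lmul deg (d 1) 1 = d 1.
  apply/mpolyP => m; rewrite /lmul -{2}mpolyX0 msuppX.
  under eq_bigr do rewrite big_seq1 addm0 mcoeff1 eqxx mulr1.
  rewrite [in RHS](mpolyE (d 1)); congr (_@_m); rewrite !big_seq; apply: eq_bigr => u u1.
  have /allP/(_ _ u1) -> := d_Lam L1.
  rewrite /sgnexp big1 ?mul1r ?mulr1 // => i _; apply: big1 => j _.
  by rewrite mnm0E muln0.
have := d_leibniz L1 L1 h1; rewrite e12 (e11 1) // e11 ?d_Lam // expr0 scale1r.
by rewrite -{1}[d 1]addr0 => /addrI.
Qed.

(** Induction on word length: split off one generator x_i and apply the Leibniz rule. The term with
    d x_i is a step at i, the other one inherits its steps from the shorter monomial. *)
Lemma d_mon m : valid deg m -> supported (fun m' => step m m' && valid deg m') (d 'X_[m]).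
Proof.
move=> vm; rewrite supported_and; apply/andP; split; last first.
  by apply: d_Lam; rewrite LamX.
have [n le_mn] := ubnP (mdeg m); elim: n m le_mn vm => // n IH m le_mn vm.
case: (boolP [exists i, 0 < m i])%N => [/existsP[i mi] | /existsPn m0]; last first.
  have -> : m = 0%MM.
    by apply/mnmP=> i; rewrite mnm0E; have := m0 i; rewrite lt0n negbK => /eqP.
  by rewrite mpolyX0 d1 supported0.
have le_i : (U_(i) <= m)%MM by apply/mnm_lepP=> j; rewrite mnm1E; case: eqP => // <-.
set m' := (m - U_(i))%MM.
have em : m = (U_(i) + m')%MM by rewrite addmC submK.
have vm' : valid deg m' by apply: valid_le vm => j; rewrite mnmBE leq_subr.
have mdm : mdeg m = (mdeg m').+1 by rewrite em mdegD mdeg1.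
have hi : hmg deg (deg i) 'X_i.
  by rewrite hmgX wdeg1.
have Lm' : isLam deg 'X_[m'] by rewrite LamX.
have -> : 'X_[m] = (-1) ^+ sgnexp deg U_(i) m' *: lmul deg 'X_i 'X_[m'].
  by rewrite lmulXX -?em // signZZ.
rewrite dZ; apply: supportedZ; rewrite (d_leibniz (isLam1 i) Lm' hi).
apply: supportedD; last apply: supportedZ.
  case: (boolP (inU i)) => iU.
    by rewrite dU // /lmul msupp0 big_nil supported0.
  apply: (@supported_lmul _ _ [in msupp (d 'X_i)] (pred1 m')); last 2 first.
  - exact/allP.
  - by rewrite supportedX /= eqxx.
  move=> u _ ui /eqP -> _; apply/stepP; exists i, u; split=> //.
  by rewrite em -addmA [(u + _)%MM]addmC.
apply: (@supported_lmul _ _ (pred1 U_(i)%MM) (step m')).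
- move=> _ m2 /eqP -> /stepP[j [u [jV mj uj e]]] _; apply/stepP; exists j, u; split=> //.
    by rewrite em mnmDE addn_gt0 mj orbT.
  by rewrite em addmA [(U_(j) + _)%MM]addmC -addmA e addmA.
- by rewrite supportedX /= eqxx.
- by apply: IH; rewrite ?mdm in le_mn *.
Qed.

Lemma step_vdeg m m' : step m m' -> vdeg m = (vdeg m').+1.
Proof.
case/stepP=> j [u [jV mj uj e]]; have [_ v0 _] := dV_supp jV uj.
by have := congr1 vdeg e; rewrite !vdegD vdeg1 jV v0 addn0.
Qed.

(** Minimality enters here: a factor from V, of U-length 0, is replaced by a monomial in U of length
    at least 2. *)
Lemma step_udeg m m' : step m m' -> (udeg m + 2 <= udeg m')%N.
Proof.
case/stepP=> j [u [jV mj uj e]]; have [_ _ u2] := dV_supp jV uj.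
have := congr1 udeg e; rewrite !udegD udeg1 (negPf jV) add0n => ->.
by rewrite leq_add2l.
Qed.

Lemma step_wdeg m m' : step m m' -> wdeg deg m' = (wdeg deg m).+1.
Proof.
case/stepP=> j [u [jV mj uj e]]; have [u2 _ _] := dV_supp jV uj.
have := congr1 (wdeg deg) e; rewrite !wdegD wdeg1 u2; lia.
Qed.

Lemma step_U m m' i : step m m' -> inU i -> (m i <= m' i)%N.
Proof.
case/stepP=> j [u [jV mj uj e]] iU.
have := congr1 (fun x : 'X_{1..k} => x i) e; rewrite /= !mnmDE mnm1E.
by case: eqP => [ji | _]; [rewrite ji iU in jV | rewrite add0n => ->; apply: leq_addr].
Qed.

Lemma step_V m m' i : step m m' -> ~~ inU i -> (m' i <= m i)%N.
Proof.
case/stepP=> j [u [jV mj uj e]] iV; have [_ /eqP v0 _] := dV_supp jV uj.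
have ui : u i = 0%N.
  by move: v0; rewrite /vdeg sum_nat_eq0 => /forallP/(_ i); rewrite iV => /eqP.
have := congr1 (fun x : 'X_{1..k} => x i) e; rewrite /= !mnmDE ui addn0 => <-.
exact: leq_addl.
Qed.

Lemma supported_d P Q p :
  (forall m m', valid deg m -> P m -> step m m' -> valid deg m' -> Q m') ->
  isLam deg p -> supported P p -> supported Q (d p).
Proof.
move=> h /allP Lp /allP Pp; rewrite [p]mpolyE d_sum; apply: supported_sum => m mp _.
rewrite dZ; apply: supportedZ; apply: supportedS (d_mon (Lp _ mp)) => m' /andP[s v].
by apply: (h m) => //; [apply: Lp | apply: Pp].
Qed.

(** Used to project an equation z = d y onto homogeneous components: [P] and [Q] select a degree
    before and after d. *)
Lemma d_restr P Q p :
  (forall m m', valid deg m -> step m m' -> valid deg m' -> Q m' = P m) ->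
  isLam deg p -> restr Q (d p) = d (restr P p).
Proof.
move=> h Lp; rewrite -{1}[p](subrK (restr P p)) addrC dD.
have LP : isLam deg (restr P p) by exact: restr_keep.
rewrite restrD restr_id; last first.
  by apply: (@supported_d P) => //; [move=> m m' v Pm s v'; rewrite (h m) | apply: restr_supp].
rewrite (restr_eq0 (p := d (p - _))) ?addr0 //; apply: (@supported_d (predC P)).
- by move=> m m' v /= Pm s v'; rewrite (h m).
- exact: supportedB.
- exact: restrC_supp.
Qed.

(** * The grading by word length in V, and monomial ideals *)

Definition inK q p := supported (fun m => valid deg m && (vdeg m == q)) p.

Lemma inKX q m : inK q 'X_[m] = valid deg m && (vdeg m == q).
Proof. exact: supportedX. Qed.

Lemma inK_Lam q p : inK q p -> isLam deg p.
Proof. by apply: supportedS => m /andP[]. Qed.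

Lemma inK_d q p : inK q.+1 p -> inK q (d p).
Proof.
move=> Kp; apply: (supported_d _ (inK_Lam Kp) Kp) => m m' _ /andP[_ vm] s v.
by rewrite v -eqSS -(step_vdeg s).
Qed.

Lemma inK0_d p : inK 0 p -> d p = 0.
Proof.
move=> Kp; apply: supported_pred0; apply: (supported_d _ (inK_Lam Kp) Kp).
by move=> m m' _ /andP[_] /[swap] /step_vdeg ->.
Qed.

Lemma inK_dd q p : inK q p -> d (d p) = 0.
Proof. by move/inK_Lam/dd0. Qed.

(* Ideals spanned by monomials are encoded as predicates on monomials;
   this one is generated by the x_i^N, i \in s. *)
Definition idl (s : seq 'I_k) (N : nat) : pred 'X_{1..k} :=
  fun m => has (fun i => N <= m i)%N s.

Lemma supported_idl0 N p : supported (idl [::] N) p -> p = 0.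
Proof. exact: supported_pred0. Qed.

Lemma idl_cons i s N m : idl s N m -> idl (i :: s) N m.
Proof. by rewrite /idl /= => ->; rewrite orbT. Qed.

Lemma idlD s N m m' : idl s N m' -> idl s N (m + m')%MM.
Proof.
by apply: sub_has => i h; rewrite mnmDE; apply: leq_trans h _; apply: leq_addl.
Qed.

Lemma idl_step s N m m' : all inU s -> step m m' -> idl s N m -> idl s N m'.
Proof.
move=> /allP sU st /hasP[i si h]; apply/hasP; exists i => //.
by apply: leq_trans h _; apply: (step_U st); apply: sU.
Qed.

Lemma idl_d s N p : all inU s -> isLam deg p ->
  supported (idl s N) p -> supported (idl s N) (d p).
Proof.
by move=> sU Lp; apply: supported_d => // m m' _ h st _; apply: idl_step h.
Qed.

Lemma idl_lmul s N p z : supported (idl s N) z -> supported (idl s N) (lmul deg p z).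
Proof.
apply: (@supported_lmul _ _ xpredT); last exact/supportedP.
by move=> m m' _ h _; apply: idlD.
Qed.

Lemma inK_lmulX u q p : vdeg u = 0%N -> inK q p -> inK q (lmul deg 'X_[u] p).
Proof.
move=> u0; apply: (@supported_lmul _ _ (pred1 u)); last by rewrite supportedX /= eqxx.
by move=> _ m /eqP -> /andP[_ vm] v; rewrite v vdegD u0.
Qed.

Lemma vdegXn i N : inU i -> vdeg (U_(i) *+ N)%MM = 0%N.
Proof.
move=> iU; apply: big1 => j jV; rewrite mulmnE mnm1E.
by case: eqP => // ij; rewrite -ij iU in jV.
Qed.

Local Notation mulX i N := (lmul deg 'X_[U_(i) *+ N]).

(** The condition under which x_i^N is a basis monomial; it covers both x_i^N for x_i even and x_i
    itself for x_i odd. *)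
Definition powable i N := ~~ odd (deg i) || (N <= 1)%N.

Lemma valid_Xn i N : powable i N -> valid deg (U_(i) *+ N)%MM.
Proof.
move=> h; apply/validP=> j oj; rewrite mulmnE mnm1E; case: eqP => // ij.
by move: h; rewrite /powable ij oj mul1n.
Qed.

Lemma d_lmulXn i N p : inU i -> powable i N -> isLam deg p ->
  d (mulX i N p) =
  (-1) ^+ wdeg deg (U_(i) *+ N) *: mulX i N (d p).
Proof.
move=> iU pN Lp; rewrite (d_leibniz (n := wdeg deg (U_(i) *+ N))) ?LamX ?hmgX ?valid_Xn //.
rewrite inK0_d ?inKX ?valid_Xn ?vdegXn ?eqxx //.
by rewrite /lmul msupp0 big_nil add0r.
Qed.

Lemma d_mulX_even i N p : inU i -> ~~ odd (deg i) -> isLam deg p ->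
  d (mulX i N p) = mulX i N (d p).
Proof.
move=> iU ei Lp; rewrite d_lmulXn ?/powable ?ei // -signr_odd /wdeg (bigD1 i) //=.
rewrite mulmnE mnm1E eqxx mul1n big1 => [|j].
  by rewrite addn0 oddM (negPf ei) andbF scale1r.
by rewrite mulmnE mnm1E eq_sym => /negPf->.
Qed.

Lemma idl_split i s N q p : inU i -> inK q p -> supported (idl (i :: s) N) p ->
  exists p1 p2, [/\ p = mulX i N p1 + p2,
    inK q p1, inK q p2 & supported (idl s N) p2].
Proof.
move=> iU Kp Ip; set A : pred 'X_{1..k} := fun m => (N <= m i)%N.
have K1 : inK q (restr A p) by exact: restr_keep.
case: (@lmulX_div _ deg (fun m => valid deg m && (vdeg m == q)) (U_(i) *+ N) (restr A p)).
- rewrite supported_and; apply/andP; split; first exact: (inK_Lam K1).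
  apply: supportedS (restr_supp A p) => m Am; apply/mnm_lepP => j.
  by rewrite mulmnE mnm1E; case: eqP => // <-; rewrite mul1n.
- exact: K1.
move=> p1 e1 K1'; exists p1, (p - restr A p); split.
- by rewrite e1 addrC subrK.
- apply: supportedS K1' => m /and3P[v _]; by rewrite v vdegD vdegXn.
- exact: supportedB.
apply: supportedS (_ : supported (fun m => predC A m && idl (i :: s) N m) _).
  by move=> m /andP[/=]; rewrite /idl /A /= => /negPf->.
rewrite supported_and restrC_supp /=; apply: supportedB => //; exact: restr_keep.
Qed.

Lemma idl_join i s N p1 p2 : supported (idl s N) p2 ->
  supported (idl (i :: s) N) (mulX i N p1 + p2).
Proof.
move=> I2; apply: supportedD; last by apply: supportedS I2 => m; apply: idl_cons.
apply: (@supported_lmul _ _ (pred1 (U_(i) *+ N)%MM) xpredT).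
- by move=> _ m /eqP-> _ _; rewrite /idl /= mnmDE mulmnE mnm1E eqxx mul1n leq_addr.
- by rewrite supportedX /= eqxx.
- exact/supportedP.
Qed.

(** An even x_i is a nonzerodivisor modulo powers of other generators: multiplying by x_i^N keeps
    monomials valid and changes no exponent that the ideal looks at. *)
Lemma idl_reg i s N p : ~~ odd (deg i) -> i \notin s -> isLam deg p ->
  supported (idl s N) (mulX i N p) -> supported (idl s N) p.
Proof.
move=> ei ns /supportedP Lp /supported_lmulX_inv/supportedP h.
apply/supportedP=> m pm; have /validP v := Lp m pm.
have vm : valid deg (U_(i) *+ N + m).
  apply/validP=> j oj; rewrite mnmDE mulmnE mnm1E; case: eqP => [ij|_].
    by rewrite ij oj in ei.
  exact: v.
have /implyP/(_ vm)/hasP[j js] := h m pm; rewrite mnmDE mulmnE mnm1E; case: eqP => [ij|_ hj].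
  by rewrite ij js in ns.
by apply/hasP; exists j.
Qed.

(** * Vanishing of homology modulo generators of U *)

(* H_q(Lambda W / I) = 0. *)
Definition van (I : pred 'X_{1..k}) q := forall z, inK q z -> supported I (d z) ->
  exists2 w, inK q.+1 w & supported I (z - d w).

(** Exactness of H_(q+1)(I) -> H_(q+1)(I, x_i^N) -> H_q(I) in the middle, where the second map is
    the connecting map sending z to (d z)/x_i^N. *)
Lemma van_even i s N q : inU i -> ~~ odd (deg i) -> i \notin s -> all inU s ->
  van (idl s N) q -> van (idl s N) q.+1 -> van (idl (i :: s) N) q.+1.
Proof.
move=> iU ei ns sU V0 V1 z Kz Iz.
have [y [e [dz Ky Ke Ie]]] := idl_split iU (inK_d Kz) Iz.
have Iy : supported (idl s N) (d y).
  apply: (idl_reg ei ns (d_Lam (inK_Lam Ky))).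
  have := inK_dd Kz; rewrite dz dD d_mulX_even ?(inK_Lam Ky) //.
  move/eqP; rewrite addr_eq0 => /eqP ->.
  by apply: supportedN; apply: idl_d; rewrite ?(inK_Lam Ke).
have [w Kw Iw] := V0 _ Ky Iy.
have KXw : inK q.+1 (mulX i N w) by apply: inK_lmulX => //; apply: vdegXn.
have [|w' Kw' Iw'] := V1 (z - mulX i N w) (supportedB Kz KXw).
  rewrite dB dz d_mulX_even ?(inK_Lam Kw) // addrAC -lmulXB.
  by apply: supportedD => //; apply: idl_lmul.
exists w' => //.
have -> : z - d w' = mulX i N w + (z - mulX i N w - d w').
  by rewrite addrA [mulX i N w + _]addrC subrK.
exact: idl_join.
Qed.

(** Modulo (J, u), with u = x_i, every class of V-degree at least q0 has a representative [o] of
    U-length at least t. Each induction step inverts z |-> (d z)/u once: d gains two in U-length and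
    the division by u loses one. *)
Lemma van_odd_aux i s q0 t : inU i -> odd (deg i) -> i \notin s -> all inU s ->
  (forall q, (q0 <= q)%N -> van (idl s 1) q) ->
  forall q z, (q0 <= q)%N -> inK q z -> supported (idl (i :: s) 1) (d z) ->
  exists w o, [/\ inK q.+1 w, inK q o, supported (fun m => (t <= udeg m)%N) o &
    supported (idl (i :: s) 1) (z - d w - o)].
Proof.
move=> iU oi ns sU V; have isU : all inU (i :: s) by rewrite /= iU.
have pN : powable i 1 by rewrite /powable orbT.
elim: t => [|t IH] q z leq Kz Iz.
  exists 0, z; split=> //; [exact: supported0 | exact/supportedP |].
  by rewrite d0 subr0 subrr supported0.
set e : rat := (-1) ^+ wdeg deg (U_(i) *+ 1).
have KX r p : inK r p -> inK r (mulX i 1 p) by apply: inK_lmulX; apply: vdegXn.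
have dX p : isLam deg p -> d (mulX i 1 p) = e *: mulX i 1 (d p).
  by move=> Lp; rewrite d_lmulXn.
(* As u^2 = 0, u z is a cocycle modulo J, hence u z = d z1 modulo J. *)
have [|z1 Kz1 Iz1] := V _ leq (mulX i 1 z) (KX _ _ Kz).
  rewrite dX ?(inK_Lam Kz) //; apply: supportedZ.
  apply: (@supported_lmul _ _ (pred1 (U_(i) *+ 1)%MM) (idl (i :: s) 1)) => //.
    move=> _ m /eqP-> /orP[mi /validP/(_ i oi)|ms _]; last exact: idlD.
    by rewrite mnmDE mulmnE mnm1E eqxx mul1n add1n ltnS leqNgt mi.
  by rewrite supportedX /= eqxx.
have Idz1 : supported (idl (i :: s) 1) (d z1).
  have -> : d z1 = mulX i 1 z + (d z1 - mulX i 1 z) by rewrite addrC subrK.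
  by apply: idl_join; rewrite -opprB; apply: supportedN.
have [w [o [Kw Ko Uo Io]]] := IH q.+1 z1 (leqW leq) Kz1 Idz1.
have Kj : inK q.+1 (z1 - d w - o).
  by apply: supportedB => //; apply: supportedB => //; apply: inK_d.
have [j1 [j2 [ej Kj1 Kj2 Ij2]]] := idl_split iU Kj Io.
have ez1 : z1 = d w + o + (mulX i 1 j1 + j2) by rewrite -ej -(addrA z1) -opprD [RHS]addrC subrK.
set y := z - e *: d j1.
have Ky : inK q y by apply: supportedB => //; apply: supportedZ; apply: inK_d.
(* Apply d to z1 = d w + o + u j1 + j2 and compare with u z: modulo J, u y = d o. *)
have Iy : supported (idl s 1) (mulX i 1 y - d o).
  rewrite /y lmulXB lmulXZ -dX ?(inK_Lam Kj1) //.
  have -> : mulX i 1 z - d (mulX i 1 j1) - d o = (mulX i 1 z - d z1) + d j2.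
    rewrite ez1 !dD (inK_dd Kw) add0r -!addrA; congr (_ + _).
    by rewrite !opprD -!addrA addNr addr0 addrC.
  by apply: supportedD => //; apply: idl_d; rewrite ?(inK_Lam Kj2).
set A : pred 'X_{1..k} := fun m => (t.+1 <= udeg m)%N.
exists (e *: j1), (restr A y); split.
- exact: supportedZ.
- exact: restr_keep.
- exact: restr_supp.
rewrite dZ -/y; apply/supportedP=> m; rewrite mcoeffB mcoeff_restr.
rewrite /A ltnNge; case: leqP => [mt|]; rewrite /= ?subrr ?eqxx // subr0 => ym.
have vm : valid deg m by have /supportedP/(_ m ym)/andP[] := Ky.
case: (boolP (0 < m i)%N) => mi; first by apply/orP; left.
rewrite -leqNgt leqn0 in mi.
suff: idl s 1 m by [].
have vm' : valid deg (U_(i) *+ 1 + m).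
  apply/validP=> j oj; rewrite mnmDE mulmnE mnm1E muln1; case: eqP => [<-|_].
    by rewrite (eqP mi).
  by move/validP: vm; apply.
(* d o has U-length at least t + 2, whereas u x^m has U-length at most t + 1. *)
have do0 : (d o)@_(U_(i) *+ 1 + m) = 0.
  apply/eqP; apply: contraT => dom.
  have /supportedP/(_ _ dom) : supported (fun m => (t + 2 <= udeg m)%N) (d o).
    apply: (supported_d _ (inK_Lam Ko) Uo) => m1 m2 _ h /step_udeg + _.
    by apply: leq_trans; rewrite leq_add2r.
  have -> : (U_(i) *+ 1)%MM = U_(i)%MM by apply/mnmP=> j; rewrite mulmnE muln1.
  by rewrite udegD udeg1 iU addn2 add1n ltnS ltnNge mt.
have /supportedP/(_ (U_(i) *+ 1 + m)%MM) := Iy.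
rewrite mcoeffB do0 subr0 mcoeff_lmulX vm' mulr1 mulf_eq0 negb_or signr_eq0.
case/(_ ym)/hasP=> j js; rewrite mnmDE mulmnE mnm1E muln1; case: eqP => [ij|_ mj].
  by rewrite ij js in ns.
by apply/hasP; exists j.
Qed.

Lemma van_odd i s q0 : inU i -> odd (deg i) -> i \notin s -> all inU s ->
  (forall j, inU j -> ~~ odd (deg j) -> j \in s) ->
  (forall q, (q0 <= q)%N -> van (idl s 1) q) ->
  forall q, (q0 <= q)%N -> van (idl (i :: s) 1) q.
Proof.
move=> iU oi ns sU ev V q leq z Kz Iz.
(* There are at most k odd generators, each with exponent at most 1, so a valid monomial of U-length
   above k contains an even generator of U and lies in the ideal. *)
have [w [o [Kw Ko Uo Io]]] := van_odd_aux k.+1 iU oi ns sU V leq Kz Iz.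
exists w => //; rewrite -[z - _](subrK o); apply: supportedD => //.
apply: supportedS (_ : supported (fun m => (valid deg m && (vdeg m == q)) && (k < udeg m)%N) o).
  move=> m /andP[/andP[/validP vm _] um]; apply: idl_cons; apply/hasP.
  have [j /and3P[jU ej mj] | h] := pickP [pred j | [&& inU j, ~~ odd (deg j) & (0 < m j)%N]].
    by exists j => //; apply: ev.
  suff: (udeg m <= k)%N by rewrite leqNgt um.
  rewrite /udeg -[leqRHS](card_ord k) -sum1_card big_mkcond; apply: leq_sum => j _.
  case: ifP => // jU; move: (h j) (vm j); rewrite /= jU /=; case: odd => /=; first by move=> _ ->.
  by case: (m j).
by rewrite supported_and; apply/andP.
Qed.

(** * Consequences of finite-dimensional cohomology *)

Hypothesis fin : finite_cohomology deg d.

(** Finitely many representatives involve finitely many monomials, so any weight is bounded on them;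
    it is applied to the V-degree and to the degree. *)
Lemma fin_bound (f : 'X_{1..k} -> nat) : exists B, forall z, isLam deg z -> d z = 0 ->
  exists c y, [/\ supported (fun m => f m < B)%N c, isLam deg y & z - c = d y].
Proof.
have [N [c [_ h]]] := fin.
exists (\max_(i < N) \max_(m <- msupp (c i)) f m).+1 => z Lz dz.
have [a [y [Ly e]]] := h z (conj Lz dz).
exists (\sum_(i < N) a i *: c i), y; split=> //.
apply: supported_sum => i _ _; apply: supportedZ; apply/allP => m mi.
rewrite ltnS; apply: leq_trans (leq_bigmax i); exact: leq_bigmax_seq.
Qed.

Lemma van_large N : exists q0, forall q, (q0 <= q)%N -> van (idl [::] N) q.
Proof.
have [B h] := fin_bound vdeg; exists B => q leq z Kz /supported_idl0 dz.
have [c [y [Bc Ly e]]] := h z (inK_Lam Kz) dz.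
exists (restr (fun m => vdeg m == q.+1) y).
  by rewrite /inK supported_and (restr_keep _ Ly) restr_supp.
rewrite -(@d_restr _ (fun m => vdeg m == q)) //; last first.
  by move=> m m' _ /step_vdeg ->.
rewrite -e restrB [restr _ c]restr_eq0 ?restr_id ?subr0 ?subrr ?supported0 //.
  by apply: supportedS Kz => m /andP[].
apply: supportedS Bc => m /= mB; apply/negP=> /eqP em; by rewrite em ltnNge leq in mB.
Qed.

Lemma exact_powers : exists2 N, (2 <= N)%N & forall i, inU i -> ~~ odd (deg i) ->
  exists s n, [/\ inK 1 s, hmg deg n s & d s = 'X_[U_(i) *+ N]].
Proof.
(* x_i^(B+2) has degree at least B, so [c] has no component in that degree; the 2 makes the exponent
   at least 2. *)
have [B h] := fin_bound (wdeg deg); exists B.+2 => // i iU ei.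
have pN : powable i B.+2 by rewrite /powable ei.
have KX : inK 0 'X_[U_(i) *+ B.+2] by rewrite inKX valid_Xn // vdegXn.
have [c [y [Bc Ly e]]] := h _ (inK_Lam KX) (inK0_d KX).
have wX : (B <= wdeg deg (U_(i) *+ B.+2))%N.
  rewrite /wdeg (bigD1 i) //= mulmnE mnm1E eqxx mul1n -addn2 mulnDl.
  rewrite -!addnA; apply: leq_trans (leq_addr _ _); apply: leq_pmulr.
  exact: leq_trans (deg_ge2 i).
have [n en] : exists n, wdeg deg (U_(i) *+ B.+2) = n.+1.
  have : (0 < wdeg deg (U_(i) *+ B.+2))%N.
    rewrite /wdeg (bigD1 i) //= mulmnE mnm1E eqxx mul1n addn_gt0 muln_gt0 /=.
    by rewrite (leq_trans _ (deg_ge2 i)).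
  by case: wdeg => // n _; exists n.
set A : pred 'X_{1..k} := fun m => (wdeg deg m == n) && (vdeg m == 1%N).
set A' : pred 'X_{1..k} := fun m => (wdeg deg m == n.+1) && (vdeg m == 0%N).
have sA : supported A (restr A y) by exact: restr_supp.
rewrite supported_and in sA; case/andP: sA => sA1 sA2.
(* Only the component of [y] of degree n and V-degree 1 has its differential in the bidegree of
   x_i^(B+2). *)
exists (restr A y), n; split=> //.
  by rewrite /inK supported_and (restr_keep _ Ly).
rewrite -(@d_restr _ A') //; last first.
  by move=> m m' _ st _; rewrite /A /A' (step_wdeg st) (step_vdeg st) !eqSS.
rewrite -e restrB [restr _ c]restr_eq0 ?restr_id ?subr0 //.
  by rewrite supportedX /A' en eqxx vdegXn.
apply: supportedS Bc => m /= mB; apply/negP=> /andP[/eqP em _]; by rewrite em -en ltnNge wX in mB.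
Qed.

Lemma van_evens s : uniq s -> all (fun i => inU i && ~~ odd (deg i)) s ->
  exists q0, forall q, (q0 <= q)%N -> van (idl s 1) q.
Proof.
elim: s => [_ _|i s IH /= /andP[ns us] /andP[/andP[iU ei] hs]]; first exact: van_large.
have [q0 h] := IH us hs; exists q0.+1 => [[//|q]] leq.
apply: van_even => //; [|exact: h|exact/h/leqW].
by apply: sub_all hs => j /andP[].
Qed.

Definition evU := [seq i <- enum 'I_k | inU i && ~~ odd (deg i)].

Lemma mem_evU i : (i \in evU) = inU i && ~~ odd (deg i).
Proof. by rewrite mem_filter mem_enum andbT. Qed.

Lemma evU_uniq : uniq evU.
Proof. by rewrite filter_uniq ?enum_uniq. Qed.

Lemma evU_U : all inU evU.
Proof. by apply/allP=> i; rewrite mem_evU => /andP[]. Qed.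

Lemma van_odds s : uniq s -> all (fun i => inU i && odd (deg i)) s ->
  exists q0, forall q, (q0 <= q)%N -> van (idl (s ++ evU) 1) q.
Proof.
elim: s => [_ _|i s IH /= /andP[ns us] /andP[/andP[iU oi] hs]].
  apply: van_evens evU_uniq _; apply/allP=> i; by rewrite mem_evU.
have [q0 h] := IH us hs; exists q0; apply: van_odd => //.
- by rewrite mem_cat negb_or ns mem_evU oi andbF.
- by rewrite all_cat evU_U andbT; apply: sub_all hs => j /andP[].
- by move=> j jU ej; rewrite mem_cat mem_evU jU ej orbT.
Qed.

(* For y in V of even degree, y^q would be a cocycle modulo the ideal of U,
   but not a coboundary modulo it. *)
Lemma V_odd j : ~~ inU j -> odd (deg j).
Proof.
move=> jV; apply: contraT => ej.
pose odU := [seq i <- enum 'I_k | inU i && odd (deg i)].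
have [||q0 h] := @van_odds odU.
- by rewrite filter_uniq ?enum_uniq.
- by apply/allP=> i; rewrite mem_filter => /andP[].
have inI i m : inU i -> (0 < m i)%N -> idl (odU ++ evU) 1 m.
  move=> iU mi; apply/hasP; exists i => //.
  by rewrite mem_cat mem_evU mem_filter mem_enum iU /= andbT orbN.
(* Every monomial of d p has U-length at least 2, so d vanishes modulo the ideal generated by U. *)
have dI p : isLam deg p -> supported (idl (odU ++ evU) 1) (d p).
  move=> Lp; apply: (@supported_d xpredT) => //; last exact/supportedP.
  move=> m m' _ _ /step_udeg u2 _.
  have [i /andP[iU mi] | no] := pickP [pred i | inU i && (0 < m' i)%N]; first exact: inI mi.
  suff m0 : udeg m' = 0%N by rewrite m0 addn2 in u2.
  apply: big1 => i iU; apply/eqP; have := no i; rewrite /= iU lt0n /=.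
  by move/negbFE.
have Kz : inK q0 'X_[U_(j) *+ q0].
  rewrite inKX valid_Xn; last by rewrite /powable ej.
  rewrite /vdeg (bigD1 j) //= mulmnE mnm1E eqxx mul1n big1 ?addn0 //.
  by move=> i /andP[_ ij]; rewrite mulmnE mnm1E eq_sym (negPf ij).
have [w Kw Iw] := h q0 (leqnn _) _ Kz (dI _ (inK_Lam Kz)).
have := supportedD Iw (dI w (inK_Lam Kw)); rewrite subrK supportedX => /hasP[i].
rewrite mulmnE mnm1E mem_cat mem_evU mem_filter.
by case: eqP => // <-; rewrite (negPf jV).
Qed.

Definition nV := #|[pred j | ~~ inU j]|.

Lemma vdeg_le m : valid deg m -> (vdeg m <= nV)%N.
Proof.
move=> /validP v; rewrite /nV -sum1_card; apply: leq_sum => j jV.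
by apply: v; apply: V_odd.
Qed.

Lemma inK_big q p : (nV < q)%N -> inK q p -> p = 0.
Proof.
move=> lq Kp; apply: supported_pred0; apply: supportedS Kp => m /andP[v /eqP e].
by move: (vdeg_le v); rewrite e leqNgt lq.
Qed.

(** The z a represent linearly independent classes in H_q(Lambda W / I). *)
Definition indep (I : pred 'X_{1..k}) q (T : finType) (z : T -> {mpoly rat[k]}) :=
  (forall a, inK q (z a) /\ supported I (d (z a))) /\
  (forall c : T -> rat,
    (exists2 w, inK q.+1 w & supported I (\sum_a c a *: z a - d w)) ->
    forall a, c a = 0).

Lemma indep_not_van I q (T : finType) (z : T -> {mpoly rat[k]}) (a : T) :
  indep I q z -> ~ van I q.
Proof.
move=> [h1 h2] V; have [Ka Ia] := h1 a; have [w Kw Iw] := V _ Ka Ia.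
suff /h2/(_ a)/eqP : exists2 w, inK q.+1 w & supported I (\sum_b (b == a)%:R *: z b - d w).
  by rewrite eqxx oner_eq0.
exists w => //; rewrite (bigD1 a) //= eqxx scale1r big1 ?addr0 // => b /negPf->.
by rewrite scale0r.
Qed.

(** * Homology modulo powers of the even generators of U *)

Section Powers.
Variable N : nat.
Hypothesis N_ge2 : (2 <= N)%N.
Hypothesis exactN : forall i, inU i -> ~~ odd (deg i) ->
  exists s n, [/\ inK 1 s, hmg deg n s & d s = 'X_[U_(i) *+ N]].

(** If x_i^N = d x, multiplication by x is a null homotopy of multiplication by x_i^N. *)
Lemma pow_homotopy i q z s : inU i -> ~~ odd (deg i) -> inK q z ->
  supported (idl s N) (d z) ->
  exists2 t, inK q.+1 t & supported (idl s N) (d t - mulX i N z).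
Proof.
move=> iU ei Kz Iz; have [x [n [Kx hx dx]]] := exactN iU ei.
exists (lmul deg x z).
  apply: (supported_lmul _ Kx Kz) => m m' /andP[_ /eqP vm] /andP[_ /eqP vm'] v.
  by rewrite v vdegD vm vm' add1n eqxx.
rewrite (d_leibniz (inK_Lam Kx) (inK_Lam Kz) hx) dx addrC addKr.
by apply: supportedZ; apply: idl_lmul.
Qed.

(** With all powers divided out, there are no monomials of V-degree above [nV]. Removing x_i^N from
    the ideal lowers the bound by one, since H_(q+1)(I, x_i^N) -> H_q(I) is onto: x_i^N acts as 0 on
    H_q(I). *)
Lemma van_high t s : evU = t ++ s -> forall q, (nV + size s < q + size evU)%N ->
  van (idl s N) q.
Proof.
elim/last_ind: t s => [|t i IH] s es q lq z Kz Iz.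
  exists 0; first exact: supported0.
  by rewrite (inK_big _ Kz) ?d0 ?subrr ?supported0 // -(ltn_add2r (size evU)) {1}es.
rewrite cat_rcons in es.
have : i \in evU by rewrite es mem_cat inE eqxx orbT.
rewrite mem_evU => /andP[iU ei].
have /and3P[_ _ /andP[ns _]] : [&& uniq t, ~~ has [in t] (i :: s) & uniq (i :: s)].
  by rewrite -cat_uniq -es evU_uniq.
have sU : all inU s by have := evU_U; rewrite es all_cat /= => /and3P[].
have [t' Kt It] := pow_homotopy iU ei Kz Iz.
have [||w Kw Iw] := IH _ es q.+1 _ t' Kt.
- by rewrite /= addnS addSn ltnS.
- by rewrite -[d t'](subrK (mulX i N z)) addrC; apply: idl_join.
have [e1 [e2 [ee Ke1 Ke2 Ie2]]] := idl_split iU (supportedB Kt (inK_d Kw)) Iw.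
exists e1 => //; apply: (idl_reg ei ns).
  by apply: supportedB; [exact: inK_Lam Kz | exact: d_Lam (inK_Lam Ke1)].
(* Applying d to t' - d w = x_i^N e1 + e2 shows that x_i^N (z - d e1) lies in I, where x_i^N can be
   cancelled. *)
rewrite lmulXB -d_mulX_even ?(inK_Lam Ke1) //.
have -> : mulX i N z - d (mulX i N e1) = d e2 - (d t' - mulX i N z).
  have -> : d t' = d (mulX i N e1) + d e2.
    by rewrite -dD -ee dB (inK_dd Kw) subr0.
  by rewrite opprB addrCA opprD [d e2 + _]addrC subrK.
by apply: supportedB => //; apply: idl_d => //; apply: inK_Lam Ke2.
Qed.

(** An index set with 1 + n + p elements, for 1 and the generators of U, and for the top monomial
    and its quotients by them. *)
Definition UT := option {i | inU i}.

(** The largest monomial outside the ideal of the powers; it contains every generator of V. *)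
Definition topU : 'X_{1..k} := [multinom (if inU i && ~~ odd (deg i) then N.-1 else 1)%N | i < k].
Definition top (a : UT) : 'X_{1..k} :=
  if a is Some i then (topU - U_(val i))%MM else topU.

Lemma topU_gt0 i : (0 < topU i)%N.
Proof. by rewrite mnmE; case: ifP => // _; case: N N_ge2 => [|[]]. Qed.

Lemma topE i : (U_(val i) + top (Some i))%MM = topU.
Proof.
rewrite addmC submK //; apply/mnm_lepP => j; rewrite mnm1E.
by case: eqP => // _; apply: topU_gt0.
Qed.

Lemma valid_topU : valid deg topU.
Proof. by apply/validP=> i oi; rewrite mnmE oi andbF. Qed.

Lemma valid_top a : valid deg (top a).
Proof.
apply: valid_le valid_topU => j; case: a => //= a; by rewrite mnmBE leq_subr.
Qed.

Lemma vdeg_topU : vdeg topU = nV.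
Proof.
rewrite /nV -sum1_card; apply: eq_bigr => j jV.
by rewrite mnmE (negPf jV).
Qed.

Lemma vdeg_top a : vdeg (top a) = nV.
Proof.
case: a => [a|]; last exact: vdeg_topU.
by rewrite -vdeg_topU -(topE a) vdegD vdeg1 (valP a).
Qed.

Lemma udeg_top a : (udeg topU <= (udeg (top a)).+1)%N.
Proof. by case: a => [a|]; rewrite // -(topE a) udegD udeg1 (valP a). Qed.

Lemma top_inj : injective top.
Proof.
move=> [a|] [b|] // e.
- have := topE a; rewrite e -(topE b) => /addIm/eqP; rewrite eq_mnm1 => /eqP ab.
  by congr Some; apply: val_inj.
- have /(congr1 udeg) := topE a; rewrite e /= udegD udeg1 (valP a); lia.
- have /(congr1 udeg) := topE b; rewrite -e /= udegD udeg1 (valP b); lia.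
Qed.

Lemma top_notin a : ~~ idl evU N (top a).
Proof.
apply/hasPn => i; rewrite mem_evU => /andP[iU ei]; rewrite -ltnNge.
have le : (top a i <= topU i)%N by case: a => //= a; rewrite mnmBE leq_subr.
apply: leq_ltn_trans le _; rewrite mnmE iU ei /=.
by case: N N_ge2.
Qed.

Lemma top_max m : valid deg m -> (udeg topU < udeg m)%N -> idl evU N m.
Proof.
move=> /validP v; rewrite ltnNge; apply: contraR => /hasPn h.
apply: leq_sum => i iU; rewrite mnmE iU /=; case: (boolP (odd (deg i))) => oi.
  exact: v.
have := h i; rewrite mem_evU iU oi -ltnNge => /(_ isT).
by case: N N_ge2.
Qed.

(** d raises the U-length by 2, beyond that of [topU], so these monomials are cocycles modulo the
    ideal. Nothing lives in V-degree [nV] + 1, so there are no boundaries. *)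
Lemma indep_top : indep (idl evU N) nV (fun a => 'X_[top a]).
Proof.
split=> [a|c [w Kw]].
  have Ka : inK nV 'X_[top a] by rewrite inKX valid_top vdeg_top eqxx.
  split=> //; apply: (@supported_d (pred1 (top a))); rewrite ?supportedX /= ?eqxx //.
    move=> _ m' _ /eqP -> /step_udeg st v; apply: top_max v _.
    by apply: leq_ltn_trans (udeg_top a) _; rewrite addn2 in st.
  exact: inK_Lam Ka.
rewrite (inK_big (ltnSn _) Kw) d0 subr0 => /supportedP h a; apply/eqP.
apply: contraT => ca; have := top_notin a; rewrite h //.
rewrite raddf_sum /= (bigD1 a) //= mcoeffZ mcoeffX eqxx mulr1 big1 ?addr0 // => b ba.
by rewrite mcoeffZ mcoeffX (inj_eq top_inj) (negPf ba) mulr0.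
Qed.

(** The connecting map H_(q+1)(I, x_i^N) -> H_q(I) is injective because H_(q+1)(I) = 0 by
    [van_high], so it carries the top family down one V-degree for each power removed. *)
Lemma indep_high t s : evU = t ++ s ->
  exists q (z : UT -> {mpoly rat[k]}), (q + size evU = nV + size s)%N /\ indep (idl s N) q z.
Proof.
elim/last_ind: t s => [|t i IH] s es.
  by exists nV, (fun a => 'X_[top a]); rewrite -[s]/([::] ++ s) -es; split; last exact: indep_top.
have es0 := es; rewrite cat_rcons in es.
have : i \in evU by rewrite es mem_cat inE eqxx orbT.
rewrite mem_evU => /andP[iU ei].
have /and3P[_ _ /andP[ns _]] : [&& uniq t, ~~ has [in t] (i :: s) & uniq (i :: s)].
  by rewrite -cat_uniq -es evU_uniq.
have sU : all inU s by have := evU_U; rewrite es all_cat /= => /and3P[].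
have [q [z [eq_q [Kz Hz]]]] := IH _ es.
have V : van (idl s N) q.
  by apply: (van_high es0); rewrite eq_q /= addnS ltnS.
(* In V-degree 0 the map H_0(I) -> H_0(I, x_i^N) is onto, so the target would vanish; hence V-degree
   0 is not reached too early, which yields n <= m. *)
case: q => [|q] in eq_q Kz Hz V *.
  case: (@indep_not_van (idl (i :: s) N) 0 _ z None) => //.
  move=> y Ky _; have [|w Kw Iw] := V y Ky; first by rewrite inK0_d // supported0.
  by exists w => //; apply: supportedS Iw => m; apply: idl_cons.
have /fin_all_exists[y /fin_all_exists[e h]] : forall a, exists y e,
    [/\ d (z a) = mulX i N y + e, inK q y, inK q e & supported (idl s N) e].
  by move=> a; have [Ka Ia] := Kz a; apply: idl_split => //; apply: inK_d.
exists q, y; split; first by move: eq_q; rewrite /= addSn addnS => -[].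
split=> [a|c [w Kw Iw]].
  have [da Ky Ke Ie] := h a; split=> //.
  apply: (idl_reg ei ns (d_Lam (inK_Lam Ky))).
  have := inK_dd (Kz a).1; rewrite da dD d_mulX_even ?(inK_Lam Ky) //.
  move/eqP; rewrite addr_eq0 => /eqP ->.
  by apply: supportedN; apply: idl_d; rewrite ?(inK_Lam Ke).
have KXw : inK q.+1 (mulX i N w) by apply: inK_lmulX => //; apply: vdegXn.
have KS : inK q.+1 (\sum_a c a *: z a).
  by apply: supported_sum => a _ _; apply: supportedZ; case: (Kz a).
have [|w' Kw' Iw'] := V (\sum_a c a *: z a - mulX i N w) (supportedB KS KXw).
  have -> : d (\sum_a c a *: z a - mulX i N w) =
            mulX i N (\sum_a c a *: y a - d w) + \sum_a c a *: e a.
    rewrite dB d_mulX_even ?(inK_Lam Kw) // lmulXB d_sum lmulX_sum addrAC -big_split /=.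
    congr (_ - _); apply: eq_bigr => a _; have [da _ _ _] := h a.
    by rewrite dZ da lmulXZ scalerDr.
  apply: supportedD; first exact: idl_lmul.
  by apply: supported_sum => a _ _; apply: supportedZ; case: (h a).
apply: Hz; exists w' => //.
have -> : \sum_a c a *: z a - d w' =
    mulX i N w + (\sum_a c a *: z a - mulX i N w - d w').
  by rewrite addrA [mulX i N w + _]addrC subrK.
exact: idl_join.
Qed.

End Powers.

Lemma top_homology : exists q (z : UT -> {mpoly rat[k]}),
  (q + size evU = nV)%N /\ indep pred0 q z.
Proof.
have [N N2 hN] := exact_powers.
have [q [z [e h]]] := indep_high N2 hN (esym (cats0 evU)).
by exists q, z; rewrite e addn0; split.
Qed.

(** * Rigidity: subcomplexes generated by U and a part S of V *)

Definition onS (S : seq 'I_k) : pred 'X_{1..k} :=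
  fun m => [forall j, (0 < m j)%N ==> inU j || (j \in S)].

Lemma onSP S m : reflect (forall j, (0 < m j)%N -> inU j || (j \in S)) (onS S m).
Proof.
by apply: (iffP forallP) => h j; move/(_ j): h => /implyP.
Qed.

Lemma onS_step S m m' : step m m' -> onS S m -> onS S m'.
Proof.
move=> st /onSP h; apply/onSP => j mj; case: (boolP (inU j)) => //= jV.
by have := h j (leq_trans mj (step_V st jV)); rewrite (negPf jV).
Qed.

Lemma onS_d S p : isLam deg p -> supported (onS S) p -> supported (onS S) (d p).
Proof. by move=> Lp; apply: supported_d => // m m' _ h st _; apply: onS_step h. Qed.

Lemma onS_cons j S m : onS S m -> onS (j :: S) m.
Proof. by move=> /onSP h; apply/onSP=> i /h; rewrite inE; case/orP=> ->; rewrite ?orbT. Qed.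

Lemma onS_notin j S m : ~~ inU j -> j \notin S -> onS S m -> m j = 0%N.
Proof.
move=> jV nS /onSP/(_ j); rewrite (negPf jV) (negPf nS) lt0n.
by case: eqP => // _ /(_ isT).
Qed.

Lemma inK1 j : ~~ inU j -> inK 1 'X_j.
Proof. by move=> jV; rewrite inKX -LamX isLam1 vdeg1 jV. Qed.

Lemma inK_lmul0 q p z : inK 0 p -> inK q z -> inK q (lmul deg p z).
Proof.
move=> K0 Kz; apply: (supported_lmul _ K0 Kz) => m m' /andP[_ /eqP v0] /andP[_ vq] v.
by rewrite v vdegD v0.
Qed.

Lemma onS_lmul0 S p z : inK 0 p -> supported (onS S) z ->
  supported (onS S) (lmul deg p z).
Proof.
move=> K0 Sz; apply: (supported_lmul _ K0 Sz) => m m' /andP[_ v0] /onSP h v.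
apply/onSP=> j; rewrite mnmDE addn_gt0 => /orP[mj|/h //].
case: (boolP (inU j)) => //= jV; move: v0; rewrite /vdeg sum_nat_eq0.
by move/forallP/(_ j); rewrite jV /= -leqn0 leqNgt mj.
Qed.

Lemma d_lmulV j q z : ~~ inU j -> inK q z ->
  d (lmul deg 'X_j z) = lmul deg (d 'X_j) z - lmul deg 'X_j (d z).
Proof.
move=> jV Kz; rewrite (d_leibniz (n := deg j)) ?isLam1 ?hmgX ?wdeg1 ?(inK_Lam Kz) //.
by rewrite -signr_odd V_odd // scaleN1r.
Qed.

Lemma d_lmuldV j q z : ~~ inU j -> inK q z ->
  d (lmul deg (d 'X_j) z) = lmul deg (d 'X_j) (d z).
Proof.
move=> jV Kz; have K1 := inK_d (inK1 jV).
rewrite (d_leibniz (n := (deg j).+1)) ?(inK_Lam K1) ?(inK_Lam Kz) //; last first.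
  have [_ _ h _ _] := d_diff; apply: h; first exact: isLam1.
  by rewrite hmgX wdeg1.
rewrite (inK_dd (inK1 jV)) /= -signr_odd /= V_odd // scale1r.
by rewrite /lmul msupp0 big_nil add0r.
Qed.

(** As x_j is odd, y = x_j b + a with a and b free of x_j. The only part of d y containing x_j is -
    x_j (d b), so d b = 0. [P] carries a degree bound from y to b. *)
Lemma V_split j S q y P : ~~ inU j -> j \notin S -> inK q.+1 y ->
  supported (onS (j :: S)) y -> supported P y -> supported (onS S) (d y) ->
  exists b a, [/\ y = lmul deg 'X_j b + a, d b = 0 & d y = lmul deg (d 'X_j) b + d a] /\
   [/\ inK q b, supported (onS S) b, supported (fun m => P (U_(j) + m)%MM) b,
       inK q.+1 a & supported (onS S) a].
Proof.
move=> jV nS Ky Sy Py Sdy; pose A : pred 'X_{1..k} := fun m => (0 < m j)%N.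
have onA m : onS S m -> ~~ A m by move/(onS_notin jV nS); rewrite /A => ->.
have h1 : supported (fun m => (valid deg m && (vdeg m == q.+1)) && (onS (j :: S) m && P m))
            (restr A y).
  rewrite supported_and; apply/andP; split; first exact: (restr_keep A Ky).
  by rewrite supported_and !restr_keep.
have h0 : supported (fun m => valid deg m && (U_(j) <= m)%MM) (restr A y).
  rewrite supported_and; apply/andP; split.
    by apply: restr_keep; apply: inK_Lam Ky.
  apply: supportedS (restr_supp A y) => m Am; apply/mnm_lepP => i.
  by rewrite mnm1E; case: eqP => // <-.
have [b eb hb] := lmulX_div h0 h1.
have Kb : inK q b.
  apply: supportedS hb => m /andP[v /andP[/andP[_ /eqP vq] _]].
  by move: vq; rewrite vdegD vdeg1 jV add1n => -[->]; rewrite v eqxx.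
have Sb : supported (onS S) b.
  apply: supportedS hb => m /andP[v /andP[/andP[/validP vj _] /andP[/onSP h _]]].
  have mj0 : m j = 0%N.
    by have := vj j (V_odd jV); rewrite mnmDE mnm1E eqxx add1n ltnS leqn0 => /eqP.
  apply/onSP=> i mi; have := h i; rewrite mnmDE addn_gt0 mi orbT inE => /(_ isT).
  by case: (eqVneq i j) mi => [->|//]; rewrite mj0.
set a := y - restr A y.
have Ka : inK q.+1 a by apply: supportedB => //; apply: restr_keep.
have Sa : supported (onS S) a.
  have : supported (fun m => predC A m && onS (j :: S) m) a.
    by rewrite supported_and restrC_supp supportedB // restr_keep.
  apply: supportedS => m /andP[/= nA /onSP h]; apply/onSP=> i mi.
  by have := h i mi; rewrite inE; case: (eqVneq i j) mi nA => [-> | //]; rewrite /A => ->.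
have ey : y = lmul deg 'X_j b + a by rewrite eb addrC subrK.
have dy : d y = lmul deg (d 'X_j) b + d a - lmul deg 'X_j (d b).
  by rewrite ey dD (d_lmulV jV Kb) addrAC.
have db0 : d b = 0.
  have K1 := inK_d (inK1 jV).
  have X0 : lmul deg 'X_j (d b) = 0.
    have S0 : supported (onS S) (lmul deg 'X_j (d b)).
      have -> : lmul deg 'X_j (d b) = lmul deg (d 'X_j) b + d a - d y.
        by rewrite dy opprB addrC subrK.
      apply: supportedB => //; apply: supportedD; first exact: onS_lmul0.
      by apply: onS_d => //; apply: inK_Lam Ka.
    rewrite -(@restr_eq0 _ A (lmul deg 'X_j (d b))).
      symmetry; apply: restr_id; apply: (@supported_lmul _ _ (pred1 U_(j)%MM) xpredT).
      - by move=> _ m /eqP-> _ _; rewrite /A mnmDE mnm1E eqxx.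
      - by rewrite supportedX /= eqxx.
      - exact/supportedP.
    by apply: supportedS S0.
  have /supportedP h : supported (fun m => valid deg (U_(j) + m) ==> false) (d b).
    by apply: (supported_lmulX_inv (P := pred0)); rewrite X0 supported0.
  apply: supported_pred0; apply/supportedP=> m dm.
  have /validP vm : valid deg m by have /supportedP/(_ m dm) := d_Lam (inK_Lam Kb).
  have /supportedP/(_ m dm)/(onS_notin jV nS) mj := onS_d (inK_Lam Kb) Sb.
  suff vj : valid deg (U_(j) + m) by have := h m dm; rewrite vj.
  apply/validP => i oi; rewrite mnmDE mnm1E.
  by case: eqP => [<-|_]; [rewrite mj | apply: vm].
exists b, a; split; split=> //; first by rewrite dy db0 lmulX0 subr0.
by apply: supportedS hb => m /andP[_ /andP[_ /andP[_]]].
Qed.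

Definition vanS S q := forall z, inK q z -> supported (onS S) z -> d z = 0 ->
  exists w, [/\ inK q.+1 w, supported (onS S) w & z = d w].

(* Nakayama's lemma for multiplication by d x_j on the homology of the subcomplex
   without x_j, in the form of an induction on the degree. *)
Lemma vanS_behead j S q : ~~ inU j -> j \notin S -> vanS (j :: S) q -> vanS S q.
Proof.
move=> jV nS V z Kz Sz dz.
have [D hD] : exists D, supported (fun m => wdeg deg m < D)%N z.
  exists (\max_(m <- msupp z) wdeg deg m).+1; apply/allP => m mz.
  by rewrite ltnS; exact: leq_bigmax_seq.
elim: D z hD Kz Sz dz => [|D IH] z hD Kz Sz dz.
  have z0 : z = 0 := supported_pred0 hD.
  by exists 0; rewrite d0; split=> //; apply: supported0.
have [|y [Ky Sy ey]] := V z Kz _ dz; first by apply: supportedS Sz => m; apply: onS_cons.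
(* d raises the degree by one, so this part of [y] already bounds [z], and its coefficient [b] of
   x_j has degree below D as the induction requires. *)
pose y1 := restr (fun m => wdeg deg m < D)%N y.
have ez : z = d y1.
  rewrite -(@d_restr _ (fun m => wdeg deg m < D.+1)%N) ?(inK_Lam Ky) //.
    by rewrite -ey restr_id.
  by move=> m m' _ /step_wdeg -> _; rewrite ltnS.
have Ky1 : inK q.+1 y1 by exact: restr_keep.
have Sy1 : supported (onS (j :: S)) y1 by exact: restr_keep.
have Sdy1 : supported (onS S) (d y1) by rewrite -ez.
have [b [a [[ey1 db dy1] [Kb Sb Pb Ka Sa]]]] := V_split jV nS Ky1 Sy1 (restr_supp _ y) Sdy1.
have [|c [Kc Sc ec]] := IH b _ Kb Sb db.
  apply: supportedS Pb => m; apply: leq_ltn_trans.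
  by rewrite wdegD leq_addl.
have K0 := inK_d (inK1 jV).
exists (lmul deg (d 'X_j) c + a); split.
- by apply: supportedD => //; apply: inK_lmul0.
- by apply: supportedD => //; apply: onS_lmul0.
- by rewrite dD (d_lmuldV jV Kc) -ec -dy1.
Qed.

(** Write a cocycle as z = x_j b + a. Vanishing passes to the complex without x_j, so b = d c there,
    and z + d (x_j c) = a + (d x_j) c is a cocycle free of x_j, exact by induction. *)
Lemma vanS_rigid S q : uniq S -> all (fun j => ~~ inU j) S -> vanS S q -> vanS S q.+1.
Proof.
elim: S => [_ _ _ z Kz Sz _ | j S IH /= /andP[nS uS] /andP[jV hS] V z Kz Sz dz].
  exists 0; rewrite d0; split; [exact: supported0 | exact: supported0 |].
  apply: supported_pred0.
  have : supported (fun m => (valid deg m && (vdeg m == q.+1)) && onS [::] m) z.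
    by rewrite supported_and; apply/andP.
  apply: supportedS => m /andP[/andP[_ /eqP vm] /onSP h].
  suff v0 : vdeg m = 0%N by rewrite v0 in vm.
  apply: big1 => i iV; apply/eqP; rewrite -leqn0 leqNgt; apply/negP => /h.
  by rewrite (negPf iV).
have V' := vanS_behead jV nS V.
have [||b [a [[ez db dzE] [Kb Sb _ Ka Sa]]]] := V_split jV nS Kz Sz (P := xpredT).
- exact/supportedP.
- by rewrite dz supported0.
have [c [Kc Sc ec]] := V' b Kb Sb db.
have K0 := inK_d (inK1 jV).
pose z' := a + lmul deg (d 'X_j) c.
have Kz' : inK q.+1 z' by apply: supportedD => //; apply: inK_lmul0.
have Sz' : supported (onS S) z' by apply: supportedD => //; apply: onS_lmul0.
have [|w [Kw Sw ew]] := IH uS hS V' z' Kz' Sz'.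
  by rewrite dD (d_lmuldV jV Kc) -ec addrC -dzE.
exists (w - lmul deg 'X_j c); split.
- apply: supportedB => //; apply: (supported_lmul _ (inK1 jV) Kc).
  by move=> m m' /andP[_ /eqP vm] /andP[_ /eqP vm'] v; rewrite v vdegD vm vm' add1n eqxx.
- apply: supportedB; first by apply: supportedS Sw => m; apply: onS_cons.
  apply: (@supported_lmul _ _ (pred1 U_(j)%MM) (onS S)) => //; last first.
    by rewrite supportedX /= eqxx.
  move=> _ m /eqP -> /onSP h _; apply/onSP=> i; rewrite mnmDE mnm1E inE.
  case: (eqVneq i j) => [_|ij]; rewrite ?orbT //; exact: h.
- by rewrite dB -ew (d_lmulV jV Kc) -ec /z' ez opprB addrA (addrAC a) addrK addrC.
Qed.

Lemma van_rigid q : van pred0 q -> van pred0 q.+1.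
Proof.
pose S := [seq j <- enum 'I_k | ~~ inU j].
have allS p : supported (onS S) p.
  apply/supportedP=> m _; apply/onSP=> j _.
  by rewrite mem_filter mem_enum andbT orbN.
move=> V; have VS : vanS S q.
  move=> z Kz _ dz; have [|w Kw /supported_pred0 e] := V z Kz.
    by rewrite dz supported0.
  by exists w; split=> //; apply/eqP; rewrite -subr_eq0 e.
move=> z Kz /supported_pred0 dz.
have [w [Kw _ ->]] : exists w, [/\ inK q.+2 w, supported (onS S) w & z = d w].
  apply: vanS_rigid => //; first by rewrite filter_uniq ?enum_uniq.
  by apply/allP=> j; rewrite mem_filter => /andP[].
by exists w; rewrite ?subrr ?supported0.
Qed.

(** * Counting cohomology classes *)

Definition homology_ge q b := exists z : 'I_b -> {mpoly rat[k]}, indep pred0 q z.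

Lemma indep_homology_ge q (T : finType) (z : T -> {mpoly rat[k]}) :
  indep pred0 q z -> homology_ge q #|T|.
Proof.
move=> [h1 h2]; exists (fun i => z (enum_val i)); split=> [i|c [w Kw Iw] i]; first exact: h1.
rewrite -[i]enum_valK; apply: (h2 (fun a => c (enum_rank a))); exists w => //.
rewrite (reindex (@enum_val T T)) /=; last by apply: onW_bij; apply: enum_val_bij.
by under eq_bigr do rewrite enum_valK.
Qed.

Lemma not_van_homology_ge q : ~ van pred0 q -> homology_ge q 1.
Proof.
move=> nV; apply: NNPP => nh; apply: nV => z Kz /supported_pred0 dz.
apply: NNPP => nw; apply: nh; exists (fun _ => z); split=> [_|c [w Kw]].
  by rewrite dz supported0.
rewrite big_ord1 => /supported_pred0/eqP; rewrite subr_eq0 => /eqP e i.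
rewrite [i]ord1; apply/eqP; apply: contraT => c0; case: nw.
exists ((c ord0)^-1 *: w); first exact: supportedZ.
by rewrite dZ -e scalerA mulVf // scale1r subrr supported0.
Qed.

Lemma cohom_dim_ge_sum (n : nat) (b : 'I_n -> nat) :
  (forall q : 'I_n, homology_ge q (b q)) -> cohom_dim_ge deg d (\sum_(q < n) b q).
Proof.
case/fin_all_exists=> z hz; pose T := {q : 'I_n & 'I_(b q)}.
pose zT (x : T) := z (tag x) (tagged x).
have cT : #|{: T}| = (\sum_(q < n) b q)%N.
  rewrite card_tagged sumnE big_map -big_enum /=.
  by apply: eq_bigr => q _; rewrite card_ord.
rewrite -cT; exists (fun i => zT (enum_val i)); split=> [i|c [y [Ly ey]] i].
  have [Ka /supported_pred0 da] := (hz (tag (enum_val i))).1 (tagged (enum_val i)).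
  by split=> //; apply: inK_Lam Ka.
pose C (x : T) := c (enum_rank x).
rewrite -[i]enum_valK -/(C (enum_val i)); case: (enum_val i) => q a {i}.
apply: ((hz q).2 (fun a => C (Tagged (fun r : 'I_n => 'I_(b r)) a)) _ a).
(* d lowers the V-degree by exactly one, so a relation between classes splits into its V-homogeneous
   parts. *)
exists (restr (fun m => vdeg m == q.+1) y).
  by rewrite /inK supported_and (restr_keep _ Ly) restr_supp.
rewrite -(@d_restr _ (fun m => vdeg m == q)) //; last by move=> m m' _ /step_vdeg ->.
rewrite -ey.
have -> : \sum_i c i *: zT (enum_val i) = \sum_(x : T) C x *: zT x.
  rewrite [RHS](reindex (fun i : 'I_#|{: T}| => enum_val i)) /=; last by apply: onW_bij; apply: enum_val_bij.
  by apply: eq_bigr => i _; rewrite /C enum_valK.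
have -> : \sum_(x : T) C x *: zT x =
    \sum_(r : 'I_n) \sum_(i : 'I_(b r)) C (Tagged (fun r : 'I_n => 'I_(b r)) i) *: z r i.
  rewrite (sig_big_dep xpredT (fun _ => xpredT)
    (fun (r : 'I_n) (i : 'I_(b r)) => C (Tagged (fun r : 'I_n => 'I_(b r)) i) *: z r i)) /=.
  by apply: eq_bigr => -[r i].
have hr (r : 'I_n) (i : 'I_(b r)) : restr (fun m => vdeg m == q) (z r i) = if r == q then z r i else 0.
  have [/supportedP Kr _] := (hz r).1 i; case: eqP => rq.
    by apply: restr_id; apply/supportedP => m /Kr /andP[_]; rewrite rq.
  apply: restr_eq0; apply/supportedP => m /Kr /andP[_ /eqP vm] /=.
  by rewrite vm; apply/eqP => /val_inj.
set S := \sum_(r : 'I_n) _.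
suff -> : restr (fun m => vdeg m == q) S =
    \sum_(i : 'I_(b q)) C (Tagged (fun r : 'I_n => 'I_(b r)) i) *: z q i.
  by rewrite subrr supported0.
rewrite restr_sum (bigD1 q) //= [X in _ + X]big1 ?addr0 => [|r rq].
  by rewrite restr_sum; apply: eq_bigr => i _; rewrite restrZ hr eqxx.
by rewrite restr_sum big1 // => i _; rewrite restrZ hr (negPf rq) scaler0.
Qed.

Lemma cohom_dim_ge_le r r' : (r' <= r)%N -> cohom_dim_ge deg d r -> cohom_dim_ge deg d r'.
Proof.
move=> le [z [hz h]]; exists (fun i => z (widen_ord le i)); split=> [i|a cb i]; first exact: hz.
pose a' (j : 'I_r) : rat := if insub (j : nat) is Some i then a i else 0.
have a'E i' : a' (widen_ord le i') = a i' by rewrite /a' /= valK.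
rewrite -a'E; apply: h.
rewrite (bigID (fun j : 'I_r => (j < r')%N)) /= (big_ord_narrow le) /=.
rewrite [X in _ + X]big1 ?addr0 => [|j jr]; last by rewrite /a' insubN ?scale0r.
by under eq_bigr do rewrite a'E.
Qed.

Lemma coboundary_udeg q w : inK q w -> supported (fun m => 2 <= udeg m)%N (d w).
Proof.
move=> Kw; apply: (@supported_d xpredT) (inK_Lam Kw) _; last exact/supportedP.
by move=> m m' _ _ /step_udeg + _; apply: leq_trans; apply: leq_addl.
Qed.

Definition low (a : UT) : 'X_{1..k} := if a is Some i then U_(val i)%MM else 0%MM.

Lemma low_inj : injective low.
Proof.
move=> [a|] [b|] //= e.
- by congr Some; apply: val_inj; move/eqP: e; rewrite eq_mnm1 => /eqP.
- by move/eqP: e; rewrite mnm1_eq0.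
- by move/esym/eqP: e; rewrite mnm1_eq0.
Qed.

Lemma udeg_low a : (udeg (low a) <= 1)%N.
Proof.
case: a => [a|] /=; first by rewrite udeg1 leq_b1.
by rewrite [udeg _]big1 // => i _; rewrite mnm0E.
Qed.

Lemma inK_low a : inK 0 'X_[low a].
Proof.
rewrite inKX; case: a => [a|] /=; first by rewrite -LamX isLam1 vdeg1 (valP a).
apply/andP; split; first by apply/validP => i _; rewrite mnm0E.
by apply/eqP; apply: big1 => i _; rewrite mnm0E.
Qed.

Lemma indep_low : indep pred0 0 (fun a => 'X_[low a]).
Proof.
split=> [a|c [w Kw /supported_pred0/eqP]].
  by rewrite inK0_d ?supported0 // inK_low.
rewrite subr_eq0 => /eqP e a; have /supportedP/(_ (low a)) := coboundary_udeg Kw.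
rewrite -e raddf_sum /= (bigD1 a) //= mcoeffZ mcoeffX eqxx mulr1 big1 ?addr0 => [|b ba].
  by case: eqP => // _ /(_ isT); rewrite leqNgt ltnS udeg_low.
by rewrite mcoeffZ mcoeffX (inj_eq low_inj) (negPf ba) mulr0.
Qed.

Lemma card_UT : #|{: UT}| = #|[pred i | inU i]|.+1.
Proof. by rewrite card_option card_sig. Qed.

Lemma card_gens : (#|[pred i | inU i]| + nV)%N = k.
Proof. by rewrite -[RHS]card_ord /nV -(cardC [pred i | inU i]). Qed.

Lemma size_evU_le : (size evU <= #|[pred i | inU i]|)%N.
Proof.
rewrite -(card_uniqP evU_uniq); apply: subset_leq_card; apply/subsetP => i.
by rewrite mem_evU => /andP[].
Qed.

Lemma cohom_ge_pos q : q.+1 + size evU = nV -> homology_ge q.+1 #|{: UT}| ->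
  (forall r, (r <= q.+1)%N -> ~ van pred0 r) -> cohom_dim_ge deg d k.
Proof.
move=> eq_q top_ge nv.
(* The two extreme V-degrees contribute 1 + n + p classes each, the q intermediate ones at least one
   each. *)
pose b (r : 'I_q.+2) := if (r == 0 :> nat) || (r == q.+1 :> nat) then #|{: UT}| else 1%N.
apply: (@cohom_dim_ge_le (\sum_r b r)%N); last first.
  apply: cohom_dim_ge_sum => r; rewrite /b; case: eqP => [->|_] /=.
    exact: indep_homology_ge indep_low.
  case: eqP => [->//|_]; apply: not_van_homology_ge; apply: nv.
  by rewrite -ltnS.
rewrite big_ord_recl big_ord_recr /= /b /= {2}/bump /= add1n eqxx.
rewrite (eq_bigr (fun _ => 1%N)) => [|i _]; last first.
  by rewrite /bump /= add1n eqSS (ltn_eqF (ltn_ord i)).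
rewrite sum1_card card_ord card_UT; have := card_gens; have := size_evU_le; lia.
Qed.

(** * Quadratic classes, for the case m = n *)

Definition VT := {j | ~~ inU j}.

Lemma card_VT : #|{: VT}| = nV.
Proof. by rewrite card_sig. Qed.

(** Every nonlinear monomial of [w] has a factor in U, so its differential has U-length at least 3.
    Thus the quadratic parts of coboundaries in V-degree 0 are spanned by those of the d x_j. *)
Lemma d_quadratic w m : inK 1 w -> udeg m = 2%N ->
  (d w)@_m = \sum_(j : VT) w@_U_(val j) * (d 'X_(val j))@_m.
Proof.
move=> Kw um; set w0 := \sum_(j : VT) w@_U_(val j) *: 'X_(val j).
have K0 : inK 1 w0.
  by apply: supported_sum => j _ _; apply: supportedZ; apply: inK1 (valP j).
have -> : \sum_(j : VT) w@_U_(val j) * (d 'X_(val j))@_m = (d w0)@_m.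
  rewrite d_sum raddf_sum /=; apply: eq_bigr => j _.
  by rewrite dZ mcoeffZ.
apply/eqP; rewrite -subr_eq0 -mcoeffB -dB; apply: contraT => h.
have U1 : supported (fun m => 0 < udeg m)%N (w - w0).
  apply/supportedP=> m' wm'; rewrite lt0n; apply/eqP=> u0.
  have /supportedP/(_ m' wm')/andP[_ /eqP v1] := supportedB Kw K0.
  have /eqP/mdeg1P[j /eqP ej] : mdeg m' = 1%N by rewrite mdeg_uv u0 v1.
  have jV : ~~ inU j by move: v1; rewrite ej vdeg1; case: (inU j).
  suff e0 : (w - w0)@_m' = 0 by rewrite e0 eqxx in wm'.
  rewrite mcoeffB ej /w0 raddf_sum /= (bigD1 (Sub j jV : VT)) //= mcoeffZ mcoeffX.
  rewrite eqxx mulr1 big1 ?addr0 ?subrr // => i ij.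
  rewrite mcoeffZ mcoeffX eq_mnm1; case: eqP => [e|_]; last by rewrite mulr0.
  by case/eqP: ij; apply: val_inj.
have /supportedP/(_ m h) : supported (fun m => 2 < udeg m)%N (d (w - w0)).
  apply: supported_d U1; last exact: inK_Lam (supportedB Kw K0).
  by move=> m1 m2 _ h1 /step_udeg + _; apply: leq_trans; rewrite addn2 ltnS.
by rewrite um.
Qed.

Lemma homology0_ge (T : finType) (mu : T -> 'X_{1..k}) : injective mu ->
  (forall a, [/\ valid deg (mu a), vdeg (mu a) = 0%N & udeg (mu a) = 2%N]) ->
  exists2 b, (#|T| <= b + nV)%N & homology_ge 0 (#|{: UT}| + b).
Proof.
move=> mu_inj h.
pose M : 'M[rat]_(#|{: VT}|, #|T|) :=
  \matrix_(i, j) (d 'X_(val (enum_val i : VT)))@_(mu (enum_val j)).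
(* The rows of [M] are the coordinates of the d x_j on the monomials [mu]; the rows of [C] are a
   basis of a complement of their span, of dimension at least #|T| - [nV]. *)
pose C := row_base (M^C)%MS.
exists (\rank (M^C)%MS).
  by rewrite mxrank_compl addnC -leq_subLR leq_sub2l // -card_VT rank_leq_row.
pose quad a : {mpoly rat[k]} := \sum_j C a j *: 'X_[mu (enum_val j)].
have Kq a : inK 0 (quad a).
  apply: supported_sum => j _ _; apply: supportedZ; rewrite supportedX.
  by case: (h (enum_val j)) => -> ->.
have quadE a j : (quad a)@_(mu (enum_val j)) = C a j.
  rewrite /quad raddf_sum /= (bigD1 j) //= mcoeffZ mcoeffX eqxx mulr1 big1 ?addr0 // => i ij.
  by rewrite mcoeffZ mcoeffX (inj_eq mu_inj) (inj_eq enum_val_inj) (negPf ij) mulr0.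
have quad0 a m : (udeg m <= 1)%N -> (quad a)@_m = 0.
  move=> um; rewrite /quad raddf_sum /= big1 // => j _.
  rewrite mcoeffZ mcoeffX; case: eqP => [e|_]; last by rewrite mulr0.
  by case: (h (enum_val j)) => _ _; rewrite e => u2; rewrite u2 in um.
pose z (x : UT + 'I_(\rank (M^C)%MS)) : {mpoly rat[k]} :=
  match x with inl a => 'X_[low a] | inr a => quad a end.
rewrite -[X in (_ + X)%N]card_ord -card_sum.
apply: (@indep_homology_ge 0 _ z); split=> [x|c [w Kw /supported_pred0/eqP]].
  have Kx : inK 0 (z x) by case: x => a; rewrite /z ?inK_low ?Kq.
  by rewrite inK0_d ?supported0.
rewrite subr_eq0 big_sumType /= => /eqP e.
have coefE m : \sum_(a : UT) c (inl a) * ('X_[low a] : {mpoly rat[k]})@_m +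
    \sum_a c (inr a) * (quad a)@_m = (d w)@_m.
  rewrite -e mcoeffD !raddf_sum /=; congr (_ + _);
  by apply: eq_bigr => a _; rewrite mcoeffZ.
have cl a : c (inl a) = 0.
  have := coefE (low a); have /supportedP/(_ (low a)) := coboundary_udeg Kw.
  case: eqP => [-> _ | _ /(_ isT)]; last by rewrite leqNgt ltnS udeg_low.
  rewrite [X in _ + X]big1 ?addr0; last by move=> b _; rewrite quad0 ?mulr0 ?udeg_low.
  rewrite (bigD1 a) //= mcoeffX eqxx mulr1 big1 ?addr0 // => b ba.
  by rewrite mcoeffX (inj_eq low_inj) (negPf ba) mulr0.
pose u : 'rV[rat]_(\rank (M^C)%MS) := \row_a c (inr a).
pose v : 'rV[rat]_#|{: VT}| := \row_i w@_U_(val (enum_val i : VT)).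
have uv : u *m C = v *m M.
  apply/rowP => j; rewrite !mxE; have [_ _ u2] := h (enum_val j).
  have := coefE (mu (enum_val j)); rewrite (d_quadratic Kw u2).
  rewrite big1 ?add0r => [E|a _]; last by rewrite cl mul0r.
  transitivity (\sum_a c (inr a) * (quad a)@_(mu (enum_val j))).
    by apply: eq_bigr => a _; rewrite mxE quadE.
  rewrite E (reindex (fun i : 'I_#|{: VT}| => enum_val i)) /=; last first.
    by apply: onW_bij; apply: enum_val_bij.
  by apply: eq_bigr => i _; rewrite !mxE.
(* The combination lies both in the row space of [M] and in its complement. *)
have u0 : u = 0.
  have : (u *m C <= M :&: M^C)%MS.
    rewrite sub_capmx {1}uv submxMl /=; apply: submx_trans (submxMl _ _) _.
    by rewrite eq_row_base.
  rewrite capmx_compl submx0 => /eqP uC.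
  by apply: (row_free_inj (row_base_free (M^C)%MS)); rewrite uC mul0mx.
case=> [a|a]; first exact: cl.
by have /rowP/(_ a) := u0; rewrite !mxE.
Qed.

Lemma cohom_ge_hd0 b : (k <= b)%N -> homology_ge 0 b -> cohom_dim_ge deg d k.
Proof.
move=> le h; apply: (cohom_dim_ge_le le).
have := @cohom_dim_ge_sum 1 (fun _ => b); rewrite big_ord1; apply => q.
by rewrite ord1.
Qed.

Lemma cohom_ge_zero : size evU = nV -> cohom_dim_ge deg d k.
Proof.
move=> e; case: (posnP nV) => [n0 | n_gt0].
  apply: (@cohom_ge_hd0 #|{: UT}|); last exact: indep_homology_ge indep_low.
  by rewrite card_UT -[leqLHS]card_gens n0 addn0.
have [x0 x0E] : exists x, x \in evU.
  by case: evU (e) n_gt0 => [<-//|x s _ _]; exists x; rewrite inE eqxx.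
(* [T1] indexes the n products x_0 x_i, including x_0^2, and [T2] the n - 1 other squares; at least
   n - 1 of these dimensions survive. *)
pose T1 := {i | i \in evU}; pose T2 := {i | (i \in evU) && (i != x0)}.
pose mu (a : T1 + T2) : 'X_{1..k} :=
  match a with inl i => (U_(x0) + U_(val i))%MM | inr i => (U_(val i) + U_(val i))%MM end.
have evP i : i \in evU -> inU i /\ ~~ odd (deg i) by rewrite mem_evU => /andP[].
have vE i j : i \in evU -> j \in evU ->
    [/\ valid deg (U_(i) + U_(j)), vdeg (U_(i) + U_(j)) = 0%N & udeg (U_(i) + U_(j)) = 2%N].
  move=> /evP[iU ei] /evP[jU ej]; split.
  - apply/validP=> l ol; rewrite mnmDE !mnm1E.
    by case: eqP => [il|_]; case: eqP => [jl|_] //; move: ei ej; rewrite ?il ?jl ol.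
  - by rewrite vdegD !vdeg1 iU jU.
  - by rewrite udegD !udeg1 iU jU.
have mu_inj : injective mu.
  case=> i [] j /= E.
  - by congr inl; apply: val_inj; move/addmI/eqP: E; rewrite eq_mnm1 => /eqP.
  - have /andP[_ /negPf j0] := valP j.
    by have := congr1 (fun m : 'X_{1..k} => m x0) E; rewrite /= !mnmDE !mnm1E eqxx j0.
  - have /andP[_ /negPf i0] := valP i.
    by have := congr1 (fun m : 'X_{1..k} => m x0) E; rewrite /= !mnmDE !mnm1E eqxx i0.
  - congr inr; apply: val_inj; apply/eqP.
    have := congr1 (fun m : 'X_{1..k} => m (val j)) E; rewrite /= !mnmDE !mnm1E eqxx.
    by case: eqP.
have [|b hb hH] := @homology0_ge _ mu mu_inj.
  case=> i /=; first exact: vE (valP i).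
  by have /andP[ie _] := valP i; apply: vE.
apply: cohom_ge_hd0 hH; move: hb; rewrite card_sum !card_sig.
have -> : #|[pred i | i \in evU]| = nV by rewrite -e -(card_uniqP evU_uniq); apply: eq_card.
have -> : #|[pred i | (i \in evU) && (i != x0)]| = nV.-1.
  rewrite -e -(card_uniqP evU_uniq) [in RHS](cardD1 x0) x0E /=; apply: eq_card => i.
  by rewrite !inE andbC.
rewrite card_UT; have := card_gens; lia.
Qed.

Lemma hilali_2stage : cohom_dim_ge deg d k.
Proof.
have [q [z [e hz]]] := top_homology.
case: q => [|q] in e hz *; first exact: cohom_ge_zero.
apply: (cohom_ge_pos e (indep_homology_ge hz)) => r le_r Vr.
(* By rigidity, a vanishing H_r would propagate up to the V-degree of the top classes. *)
have V : van pred0 q.+1.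
  by rewrite -(subnK le_r); elim: (q.+1 - r)%N => // i; apply: van_rigid.
exact: indep_not_van None hz V.
Qed.

End Differential.

(* (Lambda(U (+) V), d): k = dim (U (+) V) generators of degrees deg i >= 2,
   U = {x_i | inU i}; minimal, 2-stage, elliptic  ==>  dim H >= dim (U (+) V). *)
Theorem theoremA (k : nat) (deg : 'I_k -> nat) (inU : 'I_k -> bool)
    (d : {mpoly rat[k]} -> {mpoly rat[k]}) :
  (forall i, 2 <= deg i)%N ->
  is_differential deg d ->
  minimal_diff d ->
  two_stage inU d ->
  finite_cohomology deg d ->
  cohom_dim_ge deg d k.
Proof. exact: hilali_2stage. Qed.
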